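(* Let $S^2=\{(x_1,x_2,x_3)\in\mathbb R^3: x_1^2+x_2^2+x_3^2=1\}$ with the standard round metric, and let $\{Y^k_m(x)\}_{m=-k}^k$ be the standard orthonormal basis of the spherical harmonics of degree $k$, given in the coordinates $x=(\sin\phi\cos\theta,\sin\phi\sin\theta,\cos\phi)$, $\phi\in[0,\pi]$, $\theta\in[0,2\pi]$, by $$Y^k_m(\phi,\theta)=c_{m,k}P^m_k(\cos\phi)e^{im\theta},\quad -k\le m\le k.$$ Then there is a uniform constant $C$ (independent of $k$) such that $$\frac1{2k+1}\sum_{m=-k}^k\int_{S^2}|Y^k_m|^4\,dV\le C\log k,\quad k\ge 2.$$ Moreover, if $\mathbf 1=(0,0,1)$ and $r=r(x)=\min_{\pm}\operatorname{dist}(x,\pm\mathbf 1)$, then, with a uniform constant $C$ (independent of $k\ge2$ and $x\in S^2$), $$\Bigl(\sum_{m=-k}^k|Y^k_m(x)|^4\Bigr)^{1/4}\le\begin{cases} Ck^{1/4}r^{-1/4}\bigl(\log(kr)\bigr)^{1/4}, & r\ge 2/k,\\[4pt] Ck^{1/2}, & r\le 2/k.\end{cases}$$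
   Context: Here $P^m_k$ are the (associated) Legendre functions of degree $k$ and order $m$, and $c_{m,k}$ are constants chosen so that $\|Y^k_m\|_{L^2(S^2)}=1$. The functions $Y^k_m$, $-k\le m\le k$, form an orthonormal basis of the $(2k+1)$-dimensional eigenspace $\mathcal H_k$ of the Laplacian $-\Delta$ on $S^2$ with eigenvalue $k(k+1)$. $dV$ is the standard area measure on $S^2$ and $\operatorname{dist}$ is the geodesic distance on $S^2$. *)

(* Defs.v *)
From HB Require Import structures.
From mathcomp Require Import all_boot all_order all_algebra.
From mathcomp Require Import all_classical all_reals all_analysis.
From mathcomp Require Import measurable_realfun complex.

Set Implicit Arguments.
Unset Strict Implicit.
Unset Printing Implicit Defensive.

Import Order.TTheory GRing.Theory Num.Theory.
Import numFieldNormedType.Exports.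

Local Open Scope classical_set_scope.
Local Open Scope complex_scope.
Local Open Scope ring_scope.

Section legendre.
Variable R : realType.

(* Rodrigues' formula. *)
Definition legendre (k : nat) : {poly R} :=
  (2 ^+ k * (k`!)%:R)^-1 *: (('X^2 - 1) ^+ k)^`(k).

(* (1 - t^2)^(m/2) is written sqrt (1 - t^2) ^+ m, so that the value is 1 at
   t = 1, -1 when m = 0.  The Condon-Shortley sign is included. *)
Definition assoc_legendre_nat (k m : nat) (t : R) : R :=
  (-1) ^+ m * Num.sqrt (1 - t ^+ 2) ^+ m * ((legendre k)^`(m)).[t].

(* Negative orders: P^{-m}_k = (-1)^m (k-m)!/(k+m)! P^m_k, for m <= k; this is
   what Rodrigues' formula for P^m_k gives when m is allowed to be negative. *)
Definition assoc_legendre (k : nat) (m : int) (t : R) : R :=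
  match m with
  | Posz m => assoc_legendre_nat k m t
  | Negz m' => let m := m'.+1 in
      (-1) ^+ m * ((k - m)%N`!%:R / (k + m)%N`!%:R) * assoc_legendre_nat k m t
  end.

End legendre.

Section sphere.
Variable R : realType.

Definition dot3 (x y : R * R * R) : R :=
  x.1.1 * y.1.1 + x.1.2 * y.1.2 + x.2 * y.2.

Definition opp3 (x : R * R * R) : R * R * R := (- x.1.1, - x.1.2, - x.2).

Definition sphere2 : set (R * R * R) :=
  [set x | x.1.1 ^+ 2 + x.1.2 ^+ 2 + x.2 ^+ 2 = 1].

Definition spherical_coord (p : R * R) : R * R * R :=
  (sin p.1 * cos p.2, sin p.1 * sin p.2, cos p.1).

Definition coord_domain : set (R * R) := `[0, pi] `*` `[0, 2 * pi].

(* The area of A is the integral of dV = sin phi dphi dtheta over the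
   parameters (phi, theta) of the points of A.  It is a measure on R^3 carried
   by the sphere. *)
Definition sphere_area (A : set (R * R * R)) : \bar R :=
  (\int[(@lebesgue_measure R) \x (@lebesgue_measure R)]_(p in
     coord_domain `&` spherical_coord @^-1` A) (sin p.1)%:E)%E.

Lemma spherical_coordP p : sphere2 (spherical_coord p).
Proof.
rewrite /sphere2 /= !exprMn -mulrDr [_ ^+ 2 + _ ^+ 2 in X in _ * X]cos2Dsin2.
by rewrite mulr1 addrC cos2Dsin2.
Qed.

Let msin : measurable_fun [set: R] (@sin R).
Proof. by apply: continuous_measurable_fun; exact: continuous_sin. Qed.

Let mcos : measurable_fun [set: R] (@cos R).
Proof. by apply: continuous_measurable_fun; exact: continuous_cos. Qed.

Lemma measurable_spherical_coord : measurable_fun [set: R * R] spherical_coord.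
Proof.
have ms1 : measurable_fun [set: R * R] (fun p => sin p.1).
  by apply: measurableT_comp msin _; exact: measurable_fst.
have mc2 : measurable_fun [set: R * R] (fun p => cos p.2).
  by apply: measurableT_comp mcos _; exact: measurable_snd.
have ms2 : measurable_fun [set: R * R] (fun p => sin p.2).
  by apply: measurableT_comp msin _; exact: measurable_snd.
have mc1 : measurable_fun [set: R * R] (fun p => cos p.1).
  by apply: measurableT_comp mcos _; exact: measurable_fst.
apply: measurable_fun_pair => //; apply: measurable_fun_pair;
  exact: measurable_funM.
Qed.

Lemma measurable_coord_domain : measurable coord_domain.
Proof. by apply: measurableX; exact: measurable_itv. Qed.

Lemma sin_coord_domain_ge0 p : coord_domain p -> 0 <= sin p.1.
Proof. by case=> /= + _; rewrite in_itv /= => /sin_ge0_pi. Qed.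

Let area0 : sphere_area set0 = 0%E.
Proof. by rewrite /sphere_area preimage_set0 setI0 integral_set0. Qed.

Let area_ge0 A : (0 <= sphere_area A)%E.
Proof.
by apply: integral_ge0 => p [pD _]; rewrite lee_fin sin_coord_domain_ge0.
Qed.

Let area_sigma_additive : semi_sigma_additive sphere_area.
Proof.
move=> /= A mA tA mUA.
have mDA n : measurable (coord_domain `&` spherical_coord @^-1` (A n)).
  apply: measurableI; first exact: measurable_coord_domain.
  rewrite -[X in measurable X]setTI.
  exact: measurable_spherical_coord.
rewrite /sphere_area preimage_bigcup setI_bigcupr ge0_integral_bigcup//=.
- apply: is_cvg_ereal_nneg_natsum_cond => n _ _; exact: area_ge0.
- apply/measurable_EFinP; apply: measurable_funTS.
  by apply: measurableT_comp msin _; exact: measurable_fst.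
- by move=> p [n _ [pD _]]; rewrite lee_fin sin_coord_domain_ge0.
- apply/trivIsetP => i j _ _ ij.
  move/trivIsetP : tA => /(_ i j I I ij) Aij.
  by rewrite setIACA setIid -preimage_setI Aij preimage_set0 setI0.
Qed.

HB.instance Definition _ := isMeasure.Build _ _ _
  sphere_area area0 area_ge0 area_sigma_additive.

(* On the unit sphere the geodesic distance is the angle between the points,
   i.e. the length of the shorter great-circle arc joining them. *)
Definition geodesic_dist (x y : R * R * R) : R := acos (dot3 x y).

Definition north_pole : R * R * R := (0, 0, 1).

Definition pole_dist (x : R * R * R) : R :=
  Num.min (geodesic_dist x north_pole) (geodesic_dist x (opp3 north_pole)).

Definition cmod : R[i] -> R := @ComplexField.Normc.normc R.

Definition expi (t : R) : R[i] := cos t +i* sin t.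

(* Y m, for -k <= m <= k, is Y^k_m as a function on the sphere; since it is
   given by its expression in spherical coordinates, its values off the sphere
   and for |m| > k are unconstrained.  The constants c m are only required to
   normalize Y m in L^2(S^2), hence they are determined up to a phase. *)
Definition standard_spherical_harmonics
    (k : nat) (Y : int -> R * R * R -> R[i]) : Prop :=
  exists c : int -> R[i], forall m : int, - k%:Z <= m <= k%:Z ->
    (forall phi theta : R, 0 <= phi <= pi -> 0 <= theta <= 2 * pi ->
       Y m (spherical_coord (phi, theta)) =
       c m * (assoc_legendre k m (cos phi))%:C * expi (m%:~R * theta)) /\
    (\int[sphere_area]_(x in sphere2) (cmod (Y m x) ^+ 2)%:E = 1)%E.

(* \sum_(m = -k)^k F m, with m = i - k. *)
Definition sum_orders (V : nmodType) (k : nat) (F : int -> V) : V :=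
  \sum_(i < (2 * k).+1) F (i%:Z - k%:Z).

End sphere.

(* Main.v *)
Require Import Defs.
From HB Require Import structures.
From mathcomp Require Import all_boot all_order all_algebra.
From mathcomp Require Import all_classical all_reals all_analysis.
From mathcomp Require Import complex ring lra zify measurable_realfun.

(** Fix a point at height t, on the parallel of radius s = sqrt(1 - t^2). The
    values |Y^k_m|^2 there depend on |m| only, and by the addition theorem they
    are, up to the factor (2k+1)/(4 pi), the Fourier coefficients of th |->
    P_k(t^2 + (1 - t^2) cos th), that is, of the zonal harmonic centred at the
    point and restricted to its own parallel ([legendre_addition]). Parseval's
    identity turns the sum of the |Y^k_m|^4 into a multiple of the mean of
    P_k(t^2 + (1 - t^2) cos th)^2 over the parallel.

    Besides |P_k| <= 1 there, Bernstein's inequality sqrt(1 - y^2) P_k(y)^2 <=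
    2/k ([legendre_bernstein]) bounds the integrand by 2/(k s |sin th|),
    because sqrt(1 - y^2) >= s |sin th| ([parallel_sqrt_le]). The mean of
    min(1, 2/(k s |sin th|)) is at most of the order of log(1 + ks)/(ks): this
    is [zonal_sqr_sum_le], the estimate behind both claims. For the pointwise
    claim, s is comparable to the distance r to the nearer pole and the square
    of the factor (2k+1)/(4 pi) is at most k^2; near the poles the trivial
    bound by the square of the sum of the |Y^k_m|^2 suffices
    ([zonal_sqr_sum_le1]). For the integrated claim, the area element sin phi
    dphi dtheta absorbs the factor 1/s ([zonal_sqr_sum_sin_le]), so that a
    bound by k log k holds uniformly on the parameter domain.

    All ingredients are elementary. The addition theorem on a single parallel
    follows by induction on k, since both sides satisfy the three-term
    recurrence ([zonal_coef_rec]). The normalization of Y^k_m is computed from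
    it: the integrals of the Fourier coefficients over [-1, 1] do not depend on
    m ([interval_integral_zonalS]) and the coefficients add up to P_k(1) = 1.
    Bernstein's inequality is proved with Sonin's monotone function, and
    Parseval's identity is used in its discrete form ([discrete_parseval]), so
    that the logarithm comes from a harmonic sum ([harmonic_sum_le]). *)

Set Implicit Arguments.
Unset Strict Implicit.
Unset Printing Implicit Defensive.

Import Order.TTheory GRing.Theory Num.Theory.
Import numFieldNormedType.Exports.

Local Open Scope classical_set_scope.
Local Open Scope ring_scope.

(** * Legendre polynomials *)

Section legendre_recurrences.
Variable R : realType.
Implicit Types (p : {poly R}) (k m n : nat) (t : R).

Lemma derivn_mulX p n :
  ('X * p)^`(n.+1) = 'X * p^`(n.+1) + n.+1%:R * p^`(n).
Proof.
have := derivnMXaddC n p 0; rewrite polyC0 addr0 mulrC => ->.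
by rewrite mulrC addrC mulr_natl.
Qed.

Lemma derivn_mulX1 p n :
  ('X * p)^`(n) = 'X * p^`(n) + n%:R * p^`(n.-1).
Proof. by case: n => [|n]; rewrite ?derivn_mulX //= mul0r addr0. Qed.

Lemma derivnM_nat p (i : nat) n : (i%:R * p)^`(n) = i%:R * p^`(n).
Proof. by rewrite !mulr_natl derivnMn. Qed.

Lemma deriv_natM p (i : nat) : (i%:R * p)^`() = i%:R * p^`().
Proof. by rewrite !mulr_natl derivMn. Qed.

Let w : {poly R} := 'X^2 - 1.

Lemma deriv_w : w^`() = 2 * 'X.
Proof. by rewrite derivB derivXn derivC subr0 mulr_natl. Qed.

Lemma derivn_mulw p n :
  (w * p)^`(n.+2) =
  w * p^`(n.+2) + 2 * n.+2%:R * 'X * p^`(n.+1) + n.+2%:R * n.+1%:R * p^`(n).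
Proof.
have -> : w * p = 'X * ('X * p) - p by rewrite /w; ring.
rewrite derivnB !derivn_mulX /w; ring.
Qed.

(** Derivatives of (X^2 - 1)^k of all orders, before the normalization of
    Rodrigues' formula: order k + j is a multiple of the j-th derivative of
    P_k, and order k - 1 is the quantity eliminated in the proof of
    [legendreS_deriv]. *)
Let rodr k j := (w ^+ k)^`(j).

Let rodrS k j : rodr k.+1 j.+2 =
  2 * k.+1%:R * ('X * rodr k j.+1 + j.+1%:R * rodr k j).
Proof.
rewrite /rodr derivSn.
have -> : (w ^+ k.+1)^`() = (2 * k.+1)%:R * ('X * w ^+ k).
  by rewrite deriv_exp deriv_w -mulr_natl natrM; ring.
by rewrite derivnM_nat derivn_mulX natrM.
Qed.

Let norm k : {poly R} := 2 ^+ k * (k`!)%:R.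

Let norm_neq0 k : (2 ^+ k * (k`!)%:R : R) != 0.
Proof. by rewrite mulf_neq0 ?expf_neq0 // pnatr_eq0 -lt0n fact_gt0. Qed.

Let rodrE k j : rodr k (k + j) = norm k * (legendre R k)^`(j).
Proof.
rewrite /legendre derivnZ -mul_polyC mulrA.
have -> : norm k = (2 ^+ k * (k`!)%:R)%:P.
  by rewrite /norm polyCM rmorphXn /= !polyC_natr.
rewrite -polyCM divff // mul1r /rodr.
by rewrite /derivn addnC iterD.
Qed.

Let norm_poly_neq0 k : norm k != 0.
Proof.
have -> : norm k = (2 ^+ k * (k`!)%:R)%:P.
  by rewrite /norm polyCM rmorphXn /= !polyC_natr.
by rewrite polyC_eq0.
Qed.

Let normS k : norm k.+1 = 2 * k.+1%:R * norm k.
Proof. by rewrite /norm exprS factS natrM; ring. Qed.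

Local Notation P k := (legendre R k).

Lemma legendre0 : P 0 = 1.
Proof. by rewrite /legendre !expr0 fact0 mulr1 invr1 scale1r. Qed.

Let k2neq0 k : (2 * k.+1%:R : {poly R}) != 0.
Proof. by rewrite -natrM -polyC_natr polyC_eq0 pnatr_eq0. Qed.

(** Together with [legendreS_deriv] this expresses P_{k+1} and its derivative
    through P_k and its derivative; every later relation between Legendre
    polynomials of neighbouring degrees, and the differential equation, is a
    consequence of these two. *)
Lemma deriv_legendreS k : (P k.+1)^`() = 'X * (P k)^`() + k.+1%:R * P k.
Proof.
have E1 : rodr k.+1 k.+2 = norm k.+1 * (P k.+1)^`().
  by rewrite -[k.+2]addn1 rodrE derivn1.
have E2 : rodr k k.+1 = norm k * (P k)^`().
  by rewrite -[k.+1]addn1 rodrE derivn1.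
have E3 : rodr k k = norm k * P k by rewrite -{2}[k]addn0 rodrE derivn0.
have := rodrS k k; rewrite {}E1 {}E2 {}E3 normS => E.
apply: (mulfI (mulf_neq0 (k2neq0 k) (norm_poly_neq0 k))).
rewrite {}E; ring.
Qed.

(** The (k+1)-st derivative of (X^2 - 1)^(k+1) can be computed by
    differentiating either the product (X^2 - 1) (X^2 - 1)^k or the first
    derivative 2 (k+1) X (X^2 - 1)^k. Both expressions contain the derivative
    of order k - 1 of (X^2 - 1)^k, and eliminating it gives the relation. *)
Lemma legendreS_deriv k :
  k.+1%:R * P k.+1 = w * (P k)^`() + k.+1%:R * ('X * P k).
Proof.
case: k => [|k].
  rewrite legendre0 derivC mulr0 add0r !mul1r mulr1.
  rewrite /legendre !expr1 (_ : 1`!%:R = 1) // mulr1 derivn1 deriv_w.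
  have -> : 2 = 2%:P :> {poly R} by rewrite polyC_natr.
  by rewrite -mul_polyC mulrA -polyCM mulVf ?mul1r.
have E1 : rodr k.+2 k.+2 = 2 * k.+2%:R *
   ('X * rodr k.+1 k.+1 + k.+1%:R * rodr k.+1 k) by exact: rodrS.
have E2 : rodr k.+2 k.+2 = w * rodr k.+1 k.+2 +
   2 * k.+2%:R * 'X * rodr k.+1 k.+1 + k.+2%:R * k.+1%:R * rodr k.+1 k.
  by rewrite /rodr exprS derivn_mulw.
have E3 : rodr k.+2 k.+2 =
   2 * (w * rodr k.+1 k.+2 + k.+2%:R * 'X * rodr k.+1 k.+1).
  have -> : rodr k.+2 k.+2 = 2 * rodr k.+2 k.+2 - rodr k.+2 k.+2 by ring.
  rewrite {1}E2 E1; ring.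
have F1 : rodr k.+2 k.+2 = norm k.+2 * P k.+2.
  by rewrite -{2}[k.+2]addn0 rodrE derivn0.
have F2 : rodr k.+1 k.+2 = norm k.+1 * (P k.+1)^`().
  by rewrite -[k.+2]addn1 rodrE derivn1.
have F3 : rodr k.+1 k.+1 = norm k.+1 * P k.+1.
  by rewrite -{2}[k.+1]addn0 rodrE derivn0.
move: E3; rewrite {}F1 {}F2 {}F3 normS => E.
apply: (mulfI (mulf_neq0 (_ : 2 != 0) (norm_poly_neq0 k.+1))).
  by rewrite -polyC_natr polyC_eq0 pnatr_eq0.
transitivity (2 * k.+2%:R * norm k.+1 * P k.+2); first by ring.
rewrite {}E; ring.
Qed.

Lemma legendre1 : P 1 = 'X.
Proof.
have := legendreS_deriv 0.
by rewrite legendre0 derivC mulr0 add0r !mul1r mulr1.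
Qed.

Lemma legendre_ode k :
  w * (P k)^`()^`() + 2 * 'X * (P k)^`() = (k * k.+1)%:R * P k.
Proof.
have := congr1 deriv (legendreS_deriv k).
rewrite derivD !deriv_natM (derivM w) deriv_w derivM derivX mul1r.
rewrite deriv_legendreS natrM => E.
pose S := w * (P k)^`()^`() + 2 * 'X * (P k)^`() +
  k.+1%:R * (P k + 'X * (P k)^`()).
have ES : S = k.+1%:R * ('X * (P k)^`() + k.+1%:R * P k) by rewrite /S E; ring.
transitivity (S - k.+1%:R * (P k + 'X * (P k)^`())); first by rewrite /S; ring.
rewrite ES; ring.
Qed.

Lemma legendre_pred k :
  k.+1%:R * P k = k.+1%:R * ('X * P k.+1) - w * (P k.+1)^`().
Proof.
have E := legendreS_deriv k; have E' := deriv_legendreS k.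
have -> : k.+1%:R * ('X * P k.+1) = 'X * (k.+1%:R * P k.+1) by ring.
rewrite E E' /w; ring.
Qed.

Lemma deriv_legendre_pred k :
  (P k)^`() = 'X * (P k.+1)^`() - k.+1%:R * P k.+1.
Proof. rewrite deriv_legendreS legendreS_deriv /w; ring. Qed.

Lemma legendre_rec k :
  k.+2%:R * P k.+2 + k.+1%:R * P k = (2 * k.+1).+1%:R * ('X * P k.+1).
Proof.
rewrite legendreS_deriv legendre_pred; ring.
Qed.

(** The next three lemmas are the relations above differentiated m times. They
    express all that the recurrence for the coefficients [zonal_coef] needs
    through two consecutive derivatives of one P_k. *)
Lemma derivn_legendreS k m :
  (P k.+1)^`(m.+1) = 'X * (P k)^`(m.+1) + (k + m.+1)%:R * (P k)^`(m).
Proof.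
rewrite derivSn deriv_legendreS derivnD derivn_mulX1 derivnM_nat -!derivSn.
case: m => [|m] /=; rewrite ?derivn0; ring.
Qed.

Lemma derivn_legendre_pred k m :
  (P k)^`(m.+1) = 'X * (P k.+1)^`(m.+1) - (k.+1%:R - m%:R) * (P k.+1)^`(m).
Proof.
rewrite derivSn deriv_legendre_pred derivnB derivn_mulX1 derivnM_nat -!derivSn.
case: m => [|m] /=; rewrite ?derivn0; ring.
Qed.

Lemma derivn_legendre_ode k m :
  w * (P k)^`(m.+2) + 2 * m.+1%:R * 'X * (P k)^`(m.+1) =
  (k + m.+1)%:R * (k%:R - m%:R) * (P k)^`(m).
Proof.
have := congr1 (derivn m) (legendre_ode k).
rewrite -[(P k)^`()^`()]/((P k)^`(2)) derivnD -mulrA.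
rewrite (derivnM_nat _ 2) derivn_mulX1.
rewrite derivnM_nat -derivSn.
have -> : (w * (P k)^`(2))^`(m) = w * (P k)^`(m.+2) +
   2 * m%:R * 'X * (P k)^`(m.+1) + m%:R * (m%:R - 1) * (P k)^`(m).
  case: m => [|[|m]].
  - by rewrite !derivn0 !mulr0 !mul0r !addr0.
  - by rewrite derivn1 derivM deriv_w -derivnS; ring.
  - rewrite derivn_mulw.
    have D i j : ((P k)^`(i))^`(j) = (P k)^`(j + i) by rewrite /derivn iterD.
    by rewrite !D !addnS !addn0; ring.
move=> E.
have -> : (k + m.+1)%:R * (k%:R - m%:R) * (P k)^`(m) =
    (k * k.+1)%:R * (P k)^`(m) - m%:R * m.+1%:R * (P k)^`(m).
  by rewrite natrM; ring.
rewrite -E.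
case: m {E} => [|m]; first by ring.
rewrite -pred_Sn -derivSn; ring.
Qed.

End legendre_recurrences.

(** * The addition theorem on a parallel *)

Section addition_theorem.
Variable R : realType.
Implicit Types (k m n : nat) (t : R).

Local Notation P k := (legendre R k).
Let u k m t := ((P k)^`(m)).[t].

Lemma derivn_legendre_eq0 k m : (k < m)%N -> (P k)^`(m) = 0.
Proof.
elim: k m => [|k IHk] [|m] // km.
  by rewrite legendre0 derivnC.
rewrite derivn_legendreS !IHk ?mulr0 ?addr0 //; exact: ltnW.
Qed.

Let u_eq0 k m t : (k < m)%N -> u k m t = 0.
Proof. by move=> km; rewrite /u derivn_legendre_eq0 // horner0. Qed.

Let hE := (hornerM, hornerD, hornerN, hornerC, hornerX, hornerXn).

Let uS k m t : u k.+1 m.+1 t = t * u k m.+1 t + (k + m.+1)%:R * u k m t.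
Proof. by rewrite /u derivn_legendreS -polyC_natr !hE. Qed.

Let u_pred k m t :
  u k m.+1 t = t * u k.+1 m.+1 t - (k.+1%:R - m%:R) * u k.+1 m t.
Proof. by rewrite /u derivn_legendre_pred -!polyC_natr !hE. Qed.

Lemma derivn_legendre_ode_at k m t :
  (1 - t ^+ 2) * ((P k)^`(m.+2)).[t] =
  2 * m.+1%:R * t * ((P k)^`(m.+1)).[t] -
  (k + m.+1)%:R * (k%:R - m%:R) * ((P k)^`(m)).[t].
Proof.
have := congr1 (horner^~ t) (derivn_legendre_ode R k m).
rewrite -!polyC_natr !hE => <-; ring.
Qed.

Let u_ode k m t :
  (1 - t ^+ 2) * u k m.+2 t =
  2 * m.+1%:R * t * u k m.+1 t - (k + m.+1)%:R * (k%:R - m%:R) * u k m t.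
Proof. exact: derivn_legendre_ode_at. Qed.

Let uS0 k t : k.+1%:R * u k.+1 0 t =
  k.+1%:R * t * u k 0 t - (1 - t ^+ 2) * u k 1 t.
Proof.
have := congr1 (horner^~ t) (legendreS_deriv R k).
rewrite -!polyC_natr !hE => E.
rewrite [LHS]E /u derivn1; ring.
Qed.

Let u_pred0 k t : k.+1%:R * u k 0 t =
  k.+1%:R * t * u k.+1 0 t + (1 - t ^+ 2) * u k.+1 1 t.
Proof.
have := congr1 (horner^~ t) (legendre_pred R k).
rewrite -!polyC_natr !hE => E.
rewrite [LHS]E /u derivn1; ring.
Qed.

(** (k-m)!/(k+m)! P^m_k(t)^2, which is |Y^k_m|^2 at height t up to a factor
    that depends on k only. The square removes the half-integer powers of 1 -
    t^2. *)
Definition zonal_coef k m t : R :=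
  (k - m)`!%:R / (k + m)`!%:R * (1 - t ^+ 2) ^+ m * ((P k)^`(m)).[t] ^+ 2.

Let zonal_coef_eq0 k m t : (k < m)%N -> zonal_coef k m t = 0.
Proof.
by move=> km; rewrite /zonal_coef derivn_legendre_eq0 // horner0 expr0n mulr0.
Qed.

(** The cosine coefficients of 2 cos(th) times the series with coefficients a.
    The entry at 0 is doubled because the frequencies 1 and -1 both reach 0. *)
Definition mul2cos (a : nat -> R) m : R :=
  if m is m'.+1 then a m' + a m.+1 else 2 * a 1%N.

Let factn0 n : n`!%:R != 0 :> R.
Proof. by rewrite pnatr_eq0 -lt0n fact_gt0. Qed.

Let natn0 n : n.+1%:R != 0 :> R. Proof. by rewrite pnatr_eq0. Qed.

(** Coefficientwise, this is the three-term recurrence of [legendre_rec] at y =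
    t^2 + (1 - t^2) cos th, with y acting on cosine series. After expressing
    everything through two derivatives of P_{k+1} at t it is a rational
    identity. The factorials, and the division by k + 1 - m that they hide,
    single out the frequencies 0, k+1 and k+2. *)
Lemma zonal_coef_rec k m t :
  k.+2%:R * zonal_coef k.+2 m t + k.+1%:R * zonal_coef k m t =
  (2 * k.+1).+1%:R * (t ^+ 2 * zonal_coef k.+1 m t +
    (1 - t ^+ 2) / 2 * mul2cos (zonal_coef k.+1 ^~ t) m).
Proof.
case: m => [|m].
  rewrite /mul2cos /zonal_coef -!/(u _ _ t) !expr0 !subn0 !addn0.
  rewrite subSS subn0 addn1.
  rewrite !divff // !factS !natrM expr1 !mul1r.
  have -> : u k.+2 0 t =
      (k.+2%:R * t * u k.+1 0 t - (1 - t ^+ 2) * u k.+1 1 t) / k.+2%:R.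
    by rewrite -uS0 mulrC mulKf.
  have -> : u k 0 t =
      (k.+1%:R * t * u k.+1 0 t + (1 - t ^+ 2) * u k.+1 1 t) / k.+1%:R.
    by rewrite -u_pred0 mulrC mulKf.
  have f0 := factn0 k; have A := natn0 k; have B := natn0 k.+1.
  have -> : (2 * k.+1).+1%:R = k.+1%:R + k.+2%:R :> R by ring.
  have K0 : 0 <= k%:R :> R by [].
  by field; rewrite f0 /=; apply/andP; split; apply: lt0r_neq0; lra.
have [km|] := ltnP m k; last rewrite leq_eqVlt => /orP[/eqP|] km.
- have [n ->] : exists n, k = (m + n).+1.
    by exists (k - m.+1)%N; rewrite -addSn subnKC.
  rewrite /mul2cos /zonal_coef -!/(u _ _ t).
  rewrite (uS (m + n).+2 m) (u_pred (m + n).+1 m).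
  have E := u_ode (m + n).+2 m t.
  have -> : ((m + n).+3 - m.+1 = n.+2)%N by lia.
  have -> : ((m + n).+1 - m.+1 = n)%N by lia.
  have -> : ((m + n).+2 - m.+1 = n.+1)%N by lia.
  have -> : ((m + n).+2 - m = n.+2)%N by lia.
  have -> : ((m + n).+2 - m.+2 = n)%N by lia.
  have -> : ((m + n).+3 + m.+1 = (m + n + m).+4)%N by lia.
  have -> : ((m + n).+1 + m.+1 = (m + n + m).+2)%N by lia.
  have -> : ((m + n).+2 + m.+1 = (m + n + m).+3)%N by lia.
  have -> : ((m + n).+2 + m = (m + n + m).+2)%N by lia.
  have -> : ((m + n).+2 + m.+2 = (m + n + m).+4)%N by lia.
  (* The differential equation eliminates the derivative y of order m + 2, which
     only occurs multiplied by a = 1 - t^2. *)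
  move: (u _ m.+1 t) (u _ m t) (u _ m.+2 t) (1 - t ^+ 2) E => p v y a E.
  have -> : a / 2 * (n.+2`!%:R / (m + n + m).+2`!%:R * a ^+ m * v ^+ 2 +
     n`!%:R / (m + n + m).+4`!%:R * a ^+ m.+2 * y ^+ 2) =
    (n.+2`!%:R / (m + n + m).+2`!%:R * v ^+ 2 +
     n`!%:R / (m + n + m).+4`!%:R * (a * y) ^+ 2) * a ^+ m.+1 / 2.
    by rewrite !exprS; ring.
  rewrite {}E !factS !natrM.
  have f0 := factn0 n; have g0 := factn0 (m + n + m).
  have m0 : 0 <= m%:R :> R by [].
  have n0 : 0 <= n%:R :> R by [].
  field; rewrite g0 /=.
  by do ?(apply/andP; split); apply: lt0r_neq0; lra.
- rewrite {}km /mul2cos (zonal_coef_eq0 _ (ltnSn m)).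
  rewrite (zonal_coef_eq0 _ (ltnSn m.+1)).
  rewrite !addr0 mulr0 addr0 /zonal_coef -!/(u _ _ t) !subSnn !subnn.
  rewrite (uS m.+1 m).
  have := u_ode m.+1 m t; rewrite (u_eq0 _ (ltnSn m.+1)) mulr0.
  rewrite -[in m.+1%:R - m%:R]natr1 => /esym/eqP E.
  have {E} -> : u m.+1 m t = t * u m.+1 m.+1 t.
    have M0 : 2 * m.+1%:R != 0 :> R by rewrite mulf_neq0.
    apply: (mulfI M0); move: E; rewrite subr_eq0 => /eqP E.
    have -> : 2 * m.+1%:R * (t * u m.+1 m.+1 t) =
      2 * m.+1%:R * t * u m.+1 m.+1 t by ring.
    by rewrite E; ring.
  have -> : (m.+2 + m.+1 = (m + m).+3)%N by lia.
  have -> : (m.+1 + m.+1 = (m + m).+2)%N by lia.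
  have -> : (m.+1 + m = (m + m).+1)%N by lia.
  rewrite !factS !natrM fact0 exprS.
  have g0 := factn0 (m + m); have m0 : 0 <= m%:R :> R by [].
  field; rewrite g0 /=.
  by do ?(apply/andP; split); apply: lt0r_neq0; lra.
rewrite /mul2cos (zonal_coef_eq0 _ (ltnW km : (k < m.+1)%N)).
rewrite (zonal_coef_eq0 _ (km : (k.+1 < m.+1)%N)).
rewrite (zonal_coef_eq0 _ (ltnW km : (k.+1 < m.+2)%N)) !mulr0 !addr0 add0r.
move: km; rewrite leq_eqVlt => /orP[/eqP <-|km]; last first.
  by rewrite !zonal_coef_eq0 ?mulr0.
rewrite /zonal_coef -!/(u _ _ t) (uS k.+1 k.+1).
rewrite (u_eq0 _ (ltnSn k.+1)) mulr0 add0r.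
rewrite !subnn.
have -> : (k.+2 + k.+2 = (k + k).+4)%N by lia.
have -> : (k.+1 + k.+1 = (k + k).+2)%N by lia.
rewrite !factS !natrM fact0 exprS.
have g0 := factn0 (k + k); have k0 : 0 <= k%:R :> R by [].
field; rewrite g0 /=.
by do ?(apply/andP; split); apply: lt0r_neq0; lra.
Qed.

(** A real trigonometric polynomial with even coefficients a (-m) = a m; the
    frequencies m and -m are grouped. *)
Definition cosine_sum (a : nat -> R) (M : nat) (th : R) : R :=
  a 0%N + 2 * \sum_(m < M) a m.+1 * cos (m.+1%:R * th).

Let mul2cosS m (th : R) : 2 * cos th * cos (m.+1%:R * th) =
  cos (m.+2%:R * th) + cos (m%:R * th).
Proof.
have -> : m.+2%:R * th = m.+1%:R * th + th by ring.
have -> : m%:R * th = m.+1%:R * th - th by ring.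
rewrite cosD cosB; ring.
Qed.

(** The two extra terms come from cutting the series at M; they vanish when a
    vanishes from M on. *)
Lemma cosine_sum_mul2cos (a : nat -> R) M th :
  2 * cos th * cosine_sum a M th =
  cosine_sum (mul2cos a) M th +
  2 * (a M * cos (M.+1%:R * th) - a M.+1 * cos (M%:R * th)).
Proof.
elim: M => [|M].
  rewrite /cosine_sum /mul2cos !big_ord0 (mul1r th) (mul0r th) cos0; ring.
rewrite /cosine_sum !big_ord_recr /= !mulrDr.
set S := \sum_(m < M) _; set S' := \sum_(m < M) _ => IH.
have -> : 2 * cos th * (2 * (a M.+1 * cos (M.+1%:R * th))) =
   2 * a M.+1 * (2 * cos th * cos (M.+1%:R * th)) by ring.
rewrite mul2cosS addrA IH; ring.
Qed.

(** Addition theorem for two points on one parallel: at height t, points whose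
    longitudes differ by th have inner product t^2 + (1 - t^2) cos th. Both
    sides obey the three-term recurrence of [legendre_rec] in k, which by
    [zonal_coef_rec] and [cosine_sum_mul2cos] transfers to the coefficients.
    The bound M instead of k lets one truncation serve the degrees k, k+1 and
    k+2. *)
Lemma legendre_addition k M t th : (k <= M)%N ->
  cosine_sum (zonal_coef k ^~ t) M th =
  (P k).[t ^+ 2 + (1 - t ^+ 2) * cos th].
Proof.
set y := _ + _ * cos th.
have base0 K : cosine_sum (zonal_coef 0 ^~ t) K th = 1.
  rewrite /cosine_sum big1 ?mulr0 ?addr0 => [|i _]; last first.
    by rewrite zonal_coef_eq0 // mul0r.
  rewrite /zonal_coef legendre0 derivn0 (hornerC 1 t) expr0 expr1n !mulr1.
  by rewrite divff.
have [m] := ubnP k; elim: m k M => // m IHm [|[|k]] M km kM.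
- by rewrite base0 legendre0 hornerC.
- case: M kM => // M _; rewrite /cosine_sum big_ord_recl big1; last first.
    by move=> i _; rewrite zonal_coef_eq0 // mul0r.
  have -> : (@ord0 M).+1 = 1%N by [].
  have -> : zonal_coef 1 0 t = t ^+ 2.
    rewrite /zonal_coef legendre1 derivn0 hornerX expr0 mulr1.
    by rewrite divff // mul1r.
  have -> : zonal_coef 1 1 t = (1 - t ^+ 2) / 2.
    rewrite /zonal_coef legendre1 derivn1 derivX (hornerC 1 t) expr1n mulr1.
    by rewrite expr1 mul1r mulrC.
  rewrite (mul1r th) addr0 legendre1 hornerX /y.
  by field.
apply: (mulfI (natn0 k.+1)).
have -> : k.+2%:R * (P k.+2).[y] =
    (2 * k.+1).+1%:R * (y * (P k.+1).[y]) - k.+1%:R * (P k).[y].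
  have := congr1 (horner^~ y) (legendre_rec R k).
  by rewrite -!polyC_natr !hE => <-; rewrite addrK.
rewrite -(IHm k.+1 M) ?(ltnW kM) //; try by rewrite -ltnS.
rewrite -(IHm k M) ?(ltnW (ltnW kM)) //; last by rewrite -ltnS ltnW.
have := cosine_sum_mul2cos (zonal_coef k.+1 ^~ t) M th.
rewrite (zonal_coef_eq0 _ (kM : (k.+1 < M)%N)).
rewrite (zonal_coef_eq0 _ (ltnW kM : (k.+1 < M.+1)%N)).
rewrite !mul0r subr0 mulr0 addr0 => E.
have -> : y * cosine_sum (zonal_coef k.+1 ^~ t) M th =
   t ^+ 2 * cosine_sum (zonal_coef k.+1 ^~ t) M th + (1 - t ^+ 2) / 2 *
   cosine_sum (mul2cos (zonal_coef k.+1 ^~ t)) M th.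
  by rewrite -E /y; field.
have lin (a b : nat -> R) c d : c * cosine_sum a M th + d * cosine_sum b M th =
   cosine_sum (fun m => c * a m + d * b m) M th.
  rewrite /cosine_sum !mulrDr !mulr_sumr.
  rewrite addrACA -big_split /=; congr (_ + _).
  by apply: eq_bigr => i _; ring.
apply/eqP; rewrite eq_sym subr_eq eq_sym lin lin; apply/eqP.
rewrite -[RHS]addr0.
rewrite -[X in _ + X](mul0r (cosine_sum (zonal_coef k ^~ t) M th)) lin.
have eqc (a b : nat -> R) : a =1 b -> cosine_sum a M th = cosine_sum b M th.
  by move=> /funext ->.
apply: eqc => i; rewrite mul0r addr0; exact: zonal_coef_rec.
Qed.

Lemma legendre_at1 k : (P k).[1] = 1.
Proof.
elim: k => [|k IHk]; first by rewrite legendre0 (hornerC 1 1).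
have := congr1 (horner^~ 1) (legendreS_deriv R k).
rewrite -!polyC_natr !hE IHk !mulr1 subrr mul0r add0r => E.
by apply: (mulfI (natn0 k)); rewrite E mulr1.
Qed.

Lemma sum_zonal_coef k t : cosine_sum (zonal_coef k ^~ t) k 0 = 1.
Proof. by rewrite legendre_addition // cos0 mulr1 addrC subrK legendre_at1. Qed.

Lemma zonal_coef_ge0 k m t : -1 <= t <= 1 -> 0 <= zonal_coef k m t.
Proof.
move=> t1; rewrite /zonal_coef; apply: mulr_ge0 (sqr_ge0 _).
by rewrite mulr_ge0 ?divr_ge0 // exprn_ge0 //; nra.
Qed.

(** The coefficients are nonnegative, so the cosine sum is largest at th = 0.
*)
Lemma legendre_parallel_le1 k t th : -1 <= t <= 1 ->
  `|(P k).[t ^+ 2 + (1 - t ^+ 2) * cos th]| <= 1.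
Proof.
move=> t1; rewrite -(legendre_addition _ _ (leqnn k)).
rewrite -(sum_zonal_coef k t) /cosine_sum.
rewrite (le_trans (ler_normD _ _)) // ger0_norm ?zonal_coef_ge0 // lerD2l.
rewrite normrM ger0_norm // ler_pM2l // (le_trans (ler_norm_sum _ _ _)) //.
apply: ler_sum => i _; rewrite mulr0 cos0 mulr1 normrM.
by rewrite ger0_norm ?zonal_coef_ge0 // ler_piMr ?zonal_coef_ge0 // cos_max.
Qed.

End addition_theorem.

(** * Normalization on the interval [-1, 1] *)

Section normalization.
Variable R : realType.
Implicit Types (k m n : nat) (t : R).

Local Notation P k := (legendre R k).
Let u k m t := ((P k)^`(m)).[t].
Let hE := (hornerM, hornerD, hornerN, hornerC, hornerX, hornerXn).

Let u_ode k m t :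
  (1 - t ^+ 2) * u k m.+2 t =
  2 * m.+1%:R * t * u k m.+1 t - (k + m.+1)%:R * (k%:R - m%:R) * u k m t.
Proof. exact: derivn_legendre_ode_at. Qed.

Let factn0 n : n`!%:R != 0 :> R.
Proof. by rewrite pnatr_eq0 -lt0n fact_gt0. Qed.

Let natn0 n : n.+1%:R != 0 :> R. Proof. by rewrite pnatr_eq0. Qed.

Definition zonal_poly k m : {poly R} :=
  ((k - m)`!%:R / (k + m)`!%:R) *: ((1 - 'X^2) ^+ m * (P k)^`(m) ^+ 2).

Lemma zonal_polyE k m t : (zonal_poly k m).[t] = zonal_coef k m t.
Proof.
by rewrite /zonal_poly /zonal_coef hornerZ hornerM !horner_exp !hE mulrA.
Qed.

(** At i = 0 the division by zero returns the value 0 of a constant term. *)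
Definition prim (p : {poly R}) : {poly R} :=
  \poly_(i < (size p).+1) (p`_i.-1 / i%:R).

Lemma deriv_prim p : (prim p)^`() = p.
Proof.
apply/polyP => i; rewrite coef_deriv coef_poly ltnS /=.
case: ltnP => [_|ip]; last by rewrite mul0rn nth_default.
by rewrite -[LHS]mulr_natr divfK.
Qed.

(** The integral over [-1, 1]. Working with primitives turns integration by
    parts into an identity between polynomials. *)
Definition interval_integral (p : {poly R}) : R :=
  (prim p).[1] - (prim p).[-1].
Local Notation J := interval_integral.

Lemma deriv_eq0 (p : {poly R}) : p^`() = 0 -> p = (p`_0)%:P.
Proof.
move=> p0; apply/polyP => -[|i]; rewrite coefC //=.
have /polyP/(_ i) := p0; rewrite coef_deriv coef0 => /eqP.
by rewrite -mulr_natr mulf_eq0 pnatr_eq0 orbF => /eqP.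
Qed.

Lemma interval_integral_deriv p : J p^`() = p.[1] - p.[-1].
Proof.
have : (prim p^`() - p)^`() = 0 by rewrite derivB deriv_prim subrr.
move/deriv_eq0; set c := _`_0 => /(canRL (subrK p)) E.
by rewrite /J E !hE; ring.
Qed.

Lemma interval_integralD p q : J (p + q) = J p + J q.
Proof.
rewrite -{1}(deriv_prim p) -{1}(deriv_prim q) -derivD interval_integral_deriv.
by rewrite /J !hE; ring.
Qed.

Lemma interval_integralZ c p : J (c *: p) = c * J p.
Proof.
rewrite -{1}(deriv_prim p) -derivZ interval_integral_deriv.
by rewrite /J !hornerZ; ring.
Qed.

Lemma poly_ext (p q : {poly R}) : (forall t, p.[t] = q.[t]) -> p = q.
Proof.
move=> pq; apply/eqP; rewrite -subr_eq0; apply/negPn/negP => d0.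
pose rs := [seq (i%:R : R) | i <- iota 0 (size (p - q))].
suff : (size rs < size (p - q)%R)%N by rewrite size_map size_iota ltnn.
apply: max_poly_roots => //.
  apply/allP => x _; apply/rootP; rewrite !hE pq subrr //.
rewrite map_inj_uniq ?iota_uniq // => i j /eqP; rewrite eqr_nat; exact: eqP.
Qed.

(** Integration by parts: by the differential equation the difference of the
    two integrands is the derivative of a multiple of (1 - t^2)^(m+1) P_k^(m+1)
    P_k^(m), which vanishes at 1 and -1. *)
Lemma interval_integral_zonalS k m : (m < k)%N ->
  J (zonal_poly k m.+1) = J (zonal_poly k m).
Proof.
move=> mk; apply/eqP; rewrite -subr_eq0.
pose g : {poly R} := (1 - 'X^2) ^+ m.+1 * (P k)^`(m.+1) * (P k)^`(m).
pose c : R := (k - m.+1)`!%:R / (k + m.+1)`!%:R.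
have -> : J (zonal_poly k m.+1) - J (zonal_poly k m) = J (c *: g)^`().
  have -> : (c *: g)^`() = zonal_poly k m.+1 + (-1) *: zonal_poly k m.
    apply: poly_ext => t.
    rewrite derivZ.
    have -> : g^`() = m.+1%:R * (- (2 * 'X)) * (1 - 'X^2) ^+ m *
        (P k)^`(m.+1) * (P k)^`(m) +
        (1 - 'X^2) ^+ m.+1 * (P k)^`(m.+2) * (P k)^`(m) +
        (1 - 'X^2) ^+ m.+1 * (P k)^`(m.+1) ^+ 2.
      rewrite /g !derivM deriv_exp derivB derivXn derivC sub0r -!derivnS.
      by rewrite -mulr_natl (mulr_natl _ 2); ring.
    rewrite [RHS]hornerD zonal_polyE (hornerZ (-1)) zonal_polyE hornerZ.
    rewrite /zonal_coef.
    rewrite -!polyC_natr !(hE, horner_exp) -!/(u _ _ t).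
    have -> : (1 - t ^+ 2) ^+ m.+1 * u k m.+2 t =
       (1 - t ^+ 2) ^+ m * ((1 - t ^+ 2) * u k m.+2 t) by rewrite exprS; ring.
    rewrite u_ode /c.
    have -> : (k - m = (k - m.+1).+1)%N by lia.
    have -> : k%:R - m%:R = (k - m.+1).+1%:R :> R.
      by rewrite -natrB ?(ltnW mk) //; congr (_%:R); lia.
    rewrite addnS !factS !natrM exprS.
    have f0 := factn0 (k - m.+1); have g0 := factn0 (k + m).
    have k0 : 0 <= k%:R :> R by []; have m0 : 0 <= m%:R :> R by [].
    by field; rewrite g0 /=; apply: lt0r_neq0; lra.
  by rewrite interval_integralD (interval_integralZ (-1)) mulN1r.
rewrite interval_integral_deriv !hornerZ /g !hornerM !horner_exp !hE.
by rewrite mulrNN !mulr1 subrr expr0n !mul0r mulr0 subrr.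
Qed.

(** The 2k+1 coefficients, with the frequencies m and -m counted separately,
    add up to 1 by [sum_zonal_coef] and have equal integrals by
    [interval_integral_zonalS], so each integral is 1/(2k+1) times the length
    of [-1, 1]. *)
Lemma interval_integral_zonal k m : (m <= k)%N ->
  J (zonal_poly k m) = 2 / (2 * k).+1%:R.
Proof.
have Jm i : (i <= k)%N -> J (zonal_poly k i) = J (zonal_poly k 0).
  elim: i => // i IHi ik; rewrite interval_integral_zonalS // IHi //.
  exact: ltnW.
move=> /Jm ->.
have E : zonal_poly k 0 + 2 *: (\sum_(i < k) zonal_poly k i.+1) = 1%:P.
  apply: poly_ext => t; rewrite hornerC -[RHS](sum_zonal_coef k t) /cosine_sum.
  rewrite hornerD zonal_polyE (hornerZ 2) horner_sum; congr (_ + _ * _).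
  by apply: eq_bigr => i _; rewrite mulr0 cos0 mulr1 zonal_polyE.
have J1 : J 1%:P = 2.
  by rewrite -[1%:P](derivX R) interval_integral_deriv !hornerX; ring.
have Jsum n (F : nat -> {poly R}) : J (\sum_(i < n) F i) = \sum_(i < n) J (F i).
  elim: n => [|n IHn].
    by rewrite !big_ord0 -(scale0r 0) interval_integralZ mul0r.
  by rewrite !big_ord_recr /= interval_integralD IHn.
have := congr1 J E.
rewrite interval_integralD (interval_integralZ 2) J1.
rewrite (Jsum _ (fun i => zonal_poly k i.+1)).
rewrite (eq_bigr (fun=> J (zonal_poly k 0))) => [|i _]; last by rewrite Jm.
rewrite sumr_const card_ord -mulr_natl => F.
apply: (mulIf (natn0 (2 * k))); rewrite divfK // -[RHS]F; ring.
Qed.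

End normalization.

(** * Bernstein's inequality *)

Section bernstein.
Variable R : realType.
Implicit Types (k m n : nat) (t x : R).

Local Notation P k := (legendre R k).
Let hE := (hornerM, hornerD, hornerN, hornerC, hornerX, hornerXn).
Let natn0 n : n.+1%:R != 0 :> R. Proof. by rewrite pnatr_eq0. Qed.

Lemma legendre_at0_rec k : (k.+2%:R) * (P k.+2).[0] = - (k.+1%:R * (P k).[0]).
Proof.
have := congr1 (horner^~ 0) (legendre_rec R k).
rewrite -!polyC_natr !hE mul0r mulr0 => /eqP.
by rewrite addr_eq0 => /eqP.
Qed.

(** The recurrence gives |P_{k+2}(0)| = (k+1)/(k+2) |P_k(0)|, and (k+3) (k+1)^2
    <= (k+1) (k+2)^2. *)
Lemma legendre_at0_le k : k.+1%:R * (P k).[0] ^+ 2 <= 1.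
Proof.
have [m] := ubnP k; elim: m k => // m IHm [|[|k]] km.
- by rewrite legendre0 (hornerC 1) expr1n mulr1.
- by rewrite legendre1 hornerX expr0n mulr0.
have := IHm k (ltnW km).
have E := legendre_at0_rec k.
have {E} -> : (P k.+2).[0] = - (k.+1%:R / k.+2%:R * (P k).[0]).
  by apply: (mulfI (natn0 k.+1)); rewrite E mulrN mulrA mulrCA divff // mulr1.
move=> H; apply: le_trans H.
rewrite sqrrN exprMn mulrA ler_wpM2r ?sqr_ge0 //.
rewrite expr_div_n mulrA ler_pdivrMr ?exprn_gt0 //.
rewrite -!natrX -!natrM ler_nat; lia.
Qed.

Lemma deriv_legendre_at0 k : (P k.+1)^`().[0] = k.+1%:R * (P k).[0].
Proof.
have := congr1 (horner^~ 0) (legendre_pred R k).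
by rewrite -!polyC_natr !hE mul0r mulr0 sub0r mul0r sub0r mulN1r opprK => ->.
Qed.

Section sonin.
Variable k : nat.

Let p := P k.
Let N : R := (2 * k).+1%:R ^+ 2.
Let w : {poly R} := 1 - 'X^2.
Let d : {poly R} := N%:P * w + 1.
Let g : {poly R} := 'X * p - 2 * (w * p^`()).

(** Sonin's function. In the variable phi with x = cos phi, the function f =
    sqrt(sin phi) P_k(cos phi) satisfies f'' + q f = 0 where q = (k + 1/2)^2 +
    1/(4 sin^2 phi), so that f^2 + f'^2/q has the derivative - q' f'^2 / q^2
    and is largest at the equator. In terms of x this function is sqrt(1 - x^2)
    Phi x; its square h avoids the root. *)
Let Phi : R -> R := horner p ^+ 2 + horner g ^+ 2 * (fun x => d.[x]^-1).
Let h : R -> R := horner w * Phi ^+ 2.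

Let d_gt0 x : -1 <= x <= 1 -> 0 < d.[x].
Proof.
move=> x1; rewrite /d /w !hE ltr_wpDl // mulr_ge0 ?sqr_ge0 //; nra.
Qed.

Let dw : w^`() = - (2 * 'X).
Proof. by rewrite derivB derivXn derivC sub0r mulr_natl. Qed.

Let g' : g^`() = ((N + 1) / 2)%:P * p + 'X * p^`().
Proof.
have E := legendre_ode R k.
rewrite /g derivB derivM derivX deriv_natM derivM dw -/p mul1r.
apply: poly_ext => x; have := congr1 (horner^~ x) E.
rewrite -!polyC_natr /w !hE -/p natrM /N => F.
have -> : (1 - x * x) * ((p^`())^`()).[x] =
    2 * x * p^`().[x] - k%:R * k.+1%:R * p.[x].
  rewrite -F; ring.
by field.
Qed.

Let dh x : 0 < d.[x] -> is_derive x 1 h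
  (- 4 * x * Phi x * (g.[x] / d.[x]) ^+ 2).
Proof.
move=> dx.
have dV : is_derive x 1 (fun x => d.[x]^-1) (- d.[x] ^- 2 *: d^`().[x]).
  by apply: is_deriveV; rewrite gt_eqF.
have H := is_deriveM (is_derive_poly w x) (is_deriveX 2
  (is_deriveD (is_deriveX 2 (is_derive_poly p x))
              (is_deriveM (is_deriveX 2 (is_derive_poly g x)) dV))).
apply: is_derive_eq H _.
rewrite /Phi /= /GRing.scale /= dw g'.
have -> : d^`() = N%:P * - (2 * 'X).
  by rewrite /d derivD derivM dw !derivC mul0r add0r addr0.
have d0 : d.[x] != 0 by rewrite gt_eqF.
have E1 : 2 * (1 - x ^+ 2) * p^`().[x] = x * p.[x] - g.[x].
  by rewrite /g /w -!polyC_natr !hE; ring.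
have E2 : N * (1 - x ^+ 2) = d.[x] - 1.
  by rewrite /d /w !hE; ring.
rewrite !fctE (hornerM N%:P) hornerC.
have -> : (- (2 * 'X)).[x] = - (2 * x) by rewrite -!polyC_natr !hE.
have -> : (((N + 1) / 2)%:P * p + 'X * p^`()).[x] =
    (N + 1) / 2 * p.[x] + x * p^`().[x] by rewrite !hE.
have -> : w.[x] = 1 - x ^+ 2 by rewrite /w !hE; ring.
move: (d.[x]) (p.[x]) (p^`().[x]) (g.[x]) d0 E1 E2 => D a b c d0 E1 E2.
(* Multiplying out so that b only occurs in 2 (1 - x^2) b and N only in
   N (1 - x^2) makes the division by 1 - x^2, which may vanish, unnecessary. *)
pose Ph := a ^+ 2 + c ^+ 2 / D.
transitivity (2 * Ph * (a * (2 * (1 - x ^+ 2) * b) +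
  2 * x * c ^+ 2 * (N * (1 - x ^+ 2)) / D ^+ 2 +
  c / D * ((N * (1 - x ^+ 2) + (1 - x ^+ 2)) * a + x * (2 * (1 - x ^+ 2) * b)))
  - 2 * x * Ph ^+ 2).
  by rewrite /Ph; field.
rewrite E1 E2 /Ph; by field.
Qed.

Let Phi_ge0 x : -1 <= x <= 1 -> 0 <= Phi x.
Proof.
move=> x1; rewrite /Phi fctE addr_ge0 ?sqr_ge0 //.
by rewrite mulr_ge0 ?sqr_ge0 // invr_ge0 ltW // d_gt0.
Qed.

Let h_le x : -1 <= x <= 1 -> h x <= h 0.
Proof.
move=> /andP[x1 x2].
have der y : -1 <= y <= 1 -> derivable h y 1 /\ h^`()%classic y =
     (- 4 * y * Phi y * (g.[y] / d.[y]) ^+ 2).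
  move=> y1; have H := dh (d_gt0 y1); split; first by case: H.
  by rewrite derive1E derive_val.
have ch a b : -1 <= a -> b <= 1 -> {within `[a, b], continuous h}.
  move=> a1 b1; apply: derivable_within_continuous => y.
  rewrite in_itv /= => /andP[y1 y2]; apply: (der y _).1; lra.
have [x0|x0] := leP 0 x.
- apply: (@ler0_derive1_le_cc _ h 0 1 _ _ _ x 0 _ _ x0) => [y|y|||].
  + by rewrite in_itv /= => /andP[y1 y2]; apply: (der y _).1; lra.
  + rewrite in_itv /= => /andP[y1 y2]; rewrite (der y _).2; last lra.
    have P0 : 0 <= Phi y by apply: Phi_ge0; lra.
    have := mulr_ge0 P0 (sqr_ge0 (g.[y] / d.[y])).
    by move: (Phi y) ((_ / _) ^+ 2) => u v uv; nra.
  + by apply: ch; lra.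
  + by rewrite in_itv /= x0.
  + by rewrite in_itv /= lexx ler01.
- apply: (@ger0_derive1_ndecr _ h (-1) 0 _ _ _ x 0 x1 (ltW x0) (lexx 0))
    => [y|y|];
    last by apply: ch; lra.
  + by rewrite in_itv /= => /andP[y1 y2]; apply: (der y _).1; lra.
  + rewrite in_itv /= => /andP[y1 y2]; rewrite (der y _).2; last lra.
    have P0 : 0 <= Phi y by apply: Phi_ge0; lra.
    have := mulr_ge0 P0 (sqr_ge0 (g.[y] / d.[y])).
    by move: (Phi y) ((_ / _) ^+ 2) => u v uv; nra.
Qed.

(** At the equator only P_k(0) or P_k'(0) = k P_{k-1}(0) is nonzero, according
    to the parity of k; the bound adds the estimates for both. *)
Let Phi0_le : (0 < k)%N -> Phi 0 <= 2 / k%:R.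
Proof.
move=> k0.
have k1 : 0 < k%:R :> R by rewrite ltr0n.
have p0 : p.[0] ^+ 2 <= k%:R^-1.
  have H := legendre_at0_le k.
  rewrite -[leRHS]mul1r ler_pdivlMr // mulrC (le_trans _ H) //.
  by rewrite ler_wpM2r ?sqr_ge0 // ler_nat.
have p1 : p^`().[0] ^+ 2 <= k%:R.
  rewrite /p -(prednK k0) deriv_legendre_at0 exprMn.
  have H := legendre_at0_le k.-1.
  rewrite expr2 -mulrA -[leRHS]mulr1 ler_wpM2l //.
have -> : 2 / k%:R = k%:R^-1 + k%:R^-1 :> R by ring.
rewrite /Phi fctE /= !fctE lerD //.
have -> : g.[0] = - (2 * p^`().[0]) by rewrite /g /w -!polyC_natr !hE; ring.
have -> : d.[0] = N + 1 by rewrite /d /w !hE; ring.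
rewrite sqrrN exprMn ler_pdivrMr; last first.
  by rewrite ltr_wpDl // sqr_ge0.
rewrite [leRHS]mulrC ler_pdivlMr // /N -[(2 * k).+1]addn1 natrD natrM.
have : p^`().[0] ^+ 2 * k%:R <= k%:R * k%:R by rewrite ler_wpM2r.
move: (p^`().[0] ^+ 2) (k%:R : R) k1 => q K k1 H.
have -> : 2 ^+ 2 * q * K = 4 * (q * K) by ring.
by nra.
Qed.

(** Bernstein's inequality, from [h_le] and [Phi0_le]: P_k(x)^2 <= Phi x. *)
Lemma legendre_bernstein x : (0 < k)%N -> -1 <= x <= 1 ->
  Num.sqrt (1 - x ^+ 2) * (P k).[x] ^+ 2 <= 2 / k%:R.
Proof.
move=> k0 x1.
have w0 : 0 <= 1 - x ^+ 2 by nra.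
have c0 : 0 <= 2 / k%:R :> R by rewrite divr_ge0.
have l0 := mulr_ge0 (sqrtr_ge0 (1 - x ^+ 2)) (sqr_ge0 (P k).[x]).
rewrite -(@ler_pXn2r _ 2) ?nnegrE //.
rewrite exprMn sqr_sqrtr //.
apply: (@le_trans _ _ (h x)).
  rewrite /h !fctE /=.
  have -> : w.[x] = 1 - x ^+ 2 by rewrite /w !hE; ring.
  rewrite ler_wpM2l // ler_pXn2r ?nnegrE ?sqr_ge0 ?Phi_ge0 //.
  rewrite /Phi !fctE lerDl mulr_ge0 ?sqr_ge0 // invr_ge0 ltW // d_gt0 //.
apply: (le_trans (h_le x1)).
rewrite /h !fctE.
have -> : w.[0] = 1 by rewrite /w !hE; ring.
by rewrite mul1r ler_pXn2r ?nnegrE ?Phi_ge0 ?Phi0_le //; lra.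
Qed.

End sonin.
End bernstein.

(** * Discrete Fourier analysis and a harmonic sum *)

Section trigonometry.
Variable R : realType.
Implicit Types (k m n M : nat) (t x s th : R).

Lemma mul_cos_le_sin x : 0 <= x <= pi -> x * cos x <= sin x.
Proof.
move=> /andP[x0 xpi].
pose f : R -> R := sin - id * cos.
have df (y : R) : is_derive y 1 f (y * sin y).
  have H := is_deriveB (is_derive_sin y)
    (is_deriveM (is_derive_id y (1 : R)) (is_derive_cos y)).
  by apply: is_derive_eq H _; rewrite /GRing.scale /=; ring.
have H : f 0 <= f x.
  apply: (@ger0_derive1_ndecr _ f 0 pi _ _ _ 0 x (lexx 0) x0 xpi) => [y|y|].
  - by move=> _; case: (df y).
  - rewrite in_itv /= => /andP[y0 y1]; have H := df y.
    by rewrite derive1E derive_val mulr_ge0 ?sin_ge0_pi // ltW //= ltW.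
  - by apply: derivable_within_continuous => y _; case: (df y).
by move: H; rewrite /f !fctE /= sin0 mul0r subrr subr_ge0.
Qed.

(** A weak form of Jordan's inequality, from [mul_cos_le_sin] at x / 2: sin x
    >= x cos^2 (x/2) = x (1 + cos x) / 2. *)
Lemma half_le_sin x : 0 <= x <= pi / 2 -> x / 2 <= sin x.
Proof.
move=> /andP[x0 xpi]; have pi0 := pi_gt0 R.
have c0 : 0 <= cos x by apply: cos_ge0_pihalf; lra.
have cy0 : 0 <= cos (x / 2) by apply: cos_ge0_pihalf; lra.
have H : x / 2 * cos (x / 2) <= sin (x / 2) by apply: mul_cos_le_sin; lra.
have E1 : sin x = 2 * (cos (x / 2) * sin (x / 2)).
  by rewrite [in LHS](splitr x) sinD; ring.
have E2 : cos x = 2 * cos (x / 2) ^+ 2 - 1.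
  by rewrite [in LHS](splitr x) cosD -!expr2 sin2cos2; ring.
have {}H := ler_wpM2l cy0 H; rewrite E1.
apply: le_trans (_ : x * cos (x / 2) ^+ 2 <= _); last by nra.
nra.
Qed.

(** Sampling at the midpoints of M equal parts of [0, pi], rather than at their
    ends, avoids 0 and pi, where the bound of [legendre_bernstein] is void on a
    parallel. *)
Definition midpoint M j : R := (2 * j).+1%:R * (pi / (2 * M)%:R).

(** Multiplied by 2 sin b, where b is half of the step of the angles, the sum
    telescopes to sin (n pi) = 0. *)
Lemma sum_cos_midpoint M n : (0 < n < 2 * M)%N ->
  \sum_(j < M) cos (n%:R * midpoint M j) = 0.
Proof.
move=> /andP[n0 nM].
have M0 : (0 < M)%N by lia.
have M1 : (2 * M)%:R != 0 :> R by rewrite pnatr_eq0; lia.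
pose b : R := n%:R * (pi / (2 * M)%:R).
have sb : sin b != 0.
  have n1 : 0 < n%:R :> R by rewrite ltr0n.
  rewrite gt_eqF // sin_gt0_pi // /b; apply/andP; split.
    by rewrite mulr_gt0 // divr_gt0 ?pi_gt0 // ltr0n; lia.
  rewrite mulrCA -[ltRHS]mulr1 ltr_pM2l ?pi_gt0 //.
  by rewrite ltr_pdivrMr ?mul1r ?ltr_nat // ltr0n; lia.
have E j : 2 * sin b * cos (n%:R * midpoint M j) =
    sin ((2 * j.+1)%:R * b) - sin ((2 * j)%:R * b).
  have -> : n%:R * midpoint M j = (2 * j).+1%:R * b.
    by rewrite /midpoint /b; ring.
  have -> : (2 * j.+1)%:R * b = (2 * j).+1%:R * b + b by ring.
  have -> : (2 * j)%:R * b = (2 * j).+1%:R * b - b by ring.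
  rewrite sinD sinB; ring.
have T : 2 * sin b * (\sum_(j < M) cos (n%:R * midpoint M j)) =
    sin ((2 * M)%:R * b).
  rewrite mulr_sumr (eq_bigr _ (fun j _ => E (nat_of_ord j))).
  rewrite -(big_mkord xpredT
    (fun j => sin ((2 * j.+1)%:R * b) - sin ((2 * j)%:R * b))).
  rewrite (telescope_sumr (fun j => sin ((2 * j)%:R * b))) //.
  by rewrite mul0r sin0 subr0.
apply: (mulfI (mulf_neq0 (_ : 2 != 0) sb)); first by rewrite pnatr_eq0.
rewrite T mulr0 /b mulrCA [X in n%:R * X]mulrC divfK // mulr_natl.
elim: {n0 nM sb E T b} n => [|n IHn]; first by rewrite mulr0n sin0.
by rewrite mulrSr sinDpi IHn oppr0.
Qed.

Lemma sum_cosM_midpoint M m n : (0 < m)%N -> (0 < n)%N -> (m + n < 2 * M)%N ->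
  \sum_(j < M) cos (m%:R * midpoint M j) * cos (n%:R * midpoint M j) =
  (m == n)%:R * (M%:R / 2).
Proof.
wlog mn : m n / (m <= n)%N.
  move=> H m0 n0 mnM; have [mn|nm] := leqP m n; first exact: H.
  rewrite eq_sym -H //; [|exact: ltnW|by rewrite addnC].
  by apply: eq_bigr => j _; rewrite mulrC.
move=> m0 n0 mnM.
have E j : cos (m%:R * midpoint M j) * cos (n%:R * midpoint M j) =
    2^-1 * cos ((m + n)%:R * midpoint M j) +
    2^-1 * cos ((n - m)%:R * midpoint M j).
  rewrite natrB // natrD mulrDl mulrBl cosD cosB; by field.
rewrite (eq_bigr _ (fun j _ => E (nat_of_ord j))) big_split /= -!mulr_sumr.
rewrite sum_cos_midpoint ?mulr0 ?add0r; last by lia.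
have [->|neq] := eqVneq m n.
  rewrite subnn (eq_bigr (fun=> 1)) => [|j _]; last by rewrite mul0r cos0.
  by rewrite sumr_const card_ord mul1r mulrC.
by rewrite sum_cos_midpoint ?mulr0 ?mul0r //; lia.
Qed.

(** Parseval's identity with the mean over the circle replaced by the mean over
    finitely many angles, which is exact for frequencies below M and avoids
    integrating. *)
Lemma discrete_parseval (a : nat -> R) k M : (k < M)%N ->
  \sum_(j < M) cosine_sum a k (midpoint M j) ^+ 2 =
  M%:R * (a 0%N ^+ 2 + 2 * \sum_(m < k) a m.+1 ^+ 2).
Proof.
move=> kM; rewrite /cosine_sum.
pose S j := \sum_(m < k) a m.+1 * cos (m.+1%:R * midpoint M j).
rewrite (eq_bigr
  (fun j : 'I_M => a 0%N ^+ 2 + 4 * a 0%N * S j + 4 * S j ^+ 2)); last first.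
  by move=> j _; rewrite -/(S j); ring.
rewrite !big_split /= -!mulr_sumr sumr_const card_ord.
have -> : \sum_(j < M) S j = 0.
  rewrite exchange_big big1 //= => m _.
  by rewrite -mulr_sumr sum_cos_midpoint ?mulr0 //; have := ltn_ord m; lia.
have -> : \sum_(j < M) S j ^+ 2 = \sum_(m < k) M%:R / 2 * a m.+1 ^+ 2.
  have E j : S j ^+ 2 = \sum_(m < k) \sum_(n < k) a m.+1 * a n.+1 *
     (cos (m.+1%:R * midpoint M j) * cos (n.+1%:R * midpoint M j)).
    rewrite expr2 /S mulr_suml; apply: eq_bigr => m _.
    by rewrite mulr_sumr; apply: eq_bigr => n _; ring.
  rewrite (eq_bigr _ (fun j _ => E (nat_of_ord j))) exchange_big /=.
  apply: eq_bigr => m _; rewrite exchange_big /= (bigD1 m) //=.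
  rewrite [X in _ + X]big1 ?addr0.
    rewrite -mulr_sumr sum_cosM_midpoint ?eqxx //; last first.
      by have := ltn_ord m; lia.
    by rewrite mul1r; ring.
  move=> n nm; rewrite -mulr_sumr sum_cosM_midpoint //; last first.
    by have := ltn_ord m; have := ltn_ord n; lia.
  by rewrite eqSS eq_sym (inj_eq val_inj) (negbTE nm) mul0r mulr0.
by rewrite -mulr_sumr -[_ *+ M]mulr_natl; field.
Qed.

Lemma ler_div_lnB s x : 0 < x -> 0 <= s -> s / (x + s) <= ln (x + s) - ln x.
Proof.
move=> x0 s0; have xs : 0 < x + s by lra.
have H : -1 < - (s / (x + s)).
  by rewrite ltrN2 ltr_pdivrMr // mul1r; lra.
have := le_ln1Dx H.
have -> : 1 - s / (x + s) = x / (x + s) by field; rewrite gt_eqF.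
by rewrite ln_div ?posrE //; lra.
Qed.

(** Comparison with a logarithm; by [ler_div_lnB] the terms with j > 0 are
    dominated by a telescoping sum. *)
Lemma harmonic_sum_le s n : 0 <= s ->
  s * \sum_(j < n) (4 + s * j%:R)^-1 <= s / 4 + ln (1 + s * n%:R / 4).
Proof.
move=> s0; case: n => [|n].
  by rewrite big_ord0 mulr0n !mulr0 mul0r addr0 ln1 addr0 divr_ge0.
have -> : 1 + s * n.+1%:R / 4 = (4 + s * n.+1%:R) / 4 by field.
have p0 j : 0 < 4 + s * j%:R by rewrite ltr_wpDr // mulr_ge0.
rewrite ln_div ?posrE //.
apply: le_trans (_ : s / 4 + (ln (4 + s * n%:R) - ln 4) <= _); last first.
  rewrite lerD2l lerD2r ler_ln ?posrE // lerD2l ler_wpM2l // ler_nat //.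
elim: n => [|n IHn].
  by rewrite big_ord_recl big_ord0 mulr0n !mulr0 !addr0 subrr addr0.
rewrite big_ord_recr mulrDr /=.
have := ler_div_lnB (p0 n) s0.
have -> : 4 + s * n%:R + s = 4 + s * n.+1%:R by ring.
move: IHn; lra.
Qed.

End trigonometry.

(** * The mean square on a parallel *)

Section zonal_l2.
Variable R : realType.
Implicit Types (k m n : nat) (t x s th : R).

Local Notation P k := (legendre R k).
Local Notation sin_of t := (Num.sqrt (1 - t ^+ 2)).

(** Up to a factor that depends on k only, the sum of the |Y^k_m|^4 at height
    t. *)
Definition zonal_sqr_sum k t : R :=
  zonal_coef k 0 t ^+ 2 + 2 * \sum_(m < k) zonal_coef k m.+1 t ^+ 2.

Lemma zonal_sqr_sum_le1 k t : -1 <= t <= 1 -> zonal_sqr_sum k t <= 1.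
Proof.
move=> t1; rewrite -(sum_zonal_coef k t) /zonal_sqr_sum /cosine_sum.
have z0 m : 0 <= zonal_coef k m t by exact: zonal_coef_ge0.
have := sum_zonal_coef k t; rewrite /cosine_sum.
under eq_bigr do rewrite mulr0 cos0 mulr1.
move=> E.
have S0 : 0 <= \sum_(m < k) zonal_coef k m.+1 t by apply: sumr_ge0.
have le1 (m : nat) :
    zonal_coef k m t <= 1 -> zonal_coef k m t ^+ 2 <= zonal_coef k m t.
  by move=> H; rewrite expr2 ler_piMl.
have zm (m : 'I_k) : zonal_coef k m.+1 t <= 1.
  rewrite -E (bigD1 m) //=.
  have : 0 <= \sum_(i < k | i != m) zonal_coef k i.+1 t by apply: sumr_ge0.
  have := z0 0%N; have := z0 m.+1; lra.
apply: lerD; first by apply: le1; lra.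
by rewrite ler_pM2l // ler_sum // => m _; apply: le1.
Qed.

(** This makes [legendre_bernstein] effective on a parallel: the right-hand
    side is the sine of the angular distance of two of its points whose
    longitudes differ by th. *)
Lemma parallel_sqrt_le t th : -1 <= t <= 1 -> 0 <= sin th ->
  sin_of t * sin th <= sin_of (t ^+ 2 + (1 - t ^+ 2) * cos th).
Proof.
move=> t1 sth.
have w0 : 0 <= 1 - t ^+ 2 by nra.
rewrite -[X in _ * X](ger0_norm sth) -sqrtr_sqr -sqrtrM // ler_wsqrtr //.
rewrite sin2cos2.
have /andP[c1 c2] : -1 <= cos th <= 1 by rewrite cos_geN1 cos_le1.
move: (cos th) c1 c2 => c c1 c2.
have -> : 1 - (t ^+ 2 + (1 - t ^+ 2) * c) ^+ 2 =
    (1 - t ^+ 2) * (1 - c ^+ 2) +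
    (1 - t ^+ 2) * (1 - c) * (t ^+ 2 * (1 - c)) by ring.
rewrite lerDl mulr_ge0 //; apply: mulr_ge0 => //; first by lra.
  by apply: sqr_ge0.
by lra.
Qed.

Lemma parallel_bounds t th : -1 <= t <= 1 ->
  -1 <= t ^+ 2 + (1 - t ^+ 2) * cos th <= 1.
Proof.
move=> t1; have /andP[c1 c2] : -1 <= cos th <= 1 by rewrite cos_geN1 cos_le1.
have w0 : 0 <= 1 - t ^+ 2 by nra.
have := sqr_ge0 t.
move: (t ^+ 2) (cos th) w0 c1 c2 => u c; nra.
Qed.

Lemma sin_midpoint_ge k j : (j < 2 * k)%N ->
  (minn j (2 * k - j.+1))%:R / (2 * k)%:R <= sin (midpoint R (2 * k) j).
Proof.
move=> jk.
have k0 : 0 < (2 * k)%:R :> R by rewrite ltr0n; lia.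
have pi0 := pi_gt0 R; have pi2 := pi_ge2 R.
have H i : (2 * i < 2 * k)%N -> i%:R / (2 * k)%:R <= sin (midpoint R (2 * k) i).
  move=> ik.
  have E : midpoint R (2 * k) i = (2 * i).+1%:R / (2 * (2 * k))%:R * pi.
    by rewrite /midpoint mulrCA mulrC.
  apply: le_trans (_ : midpoint R (2 * k) i / 2 <= _).
    rewrite E.
    have -> : (2 * i).+1%:R / (2 * (2 * k))%:R * pi / 2 =
       ((2 * i).+1%:R * pi / 4) / (2 * k)%:R :> R.
      by rewrite natrM; field; rewrite pnatr_eq0; lia.
    rewrite ler_pM2r ?invr_gt0 //.
    have i0 : 0 <= i%:R :> R by [].
    have -> : (2 * i).+1%:R = 2 * i%:R + 1 :> R by ring.
    nra.
  apply: half_le_sin; rewrite E; apply/andP; split.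
    by rewrite mulr_ge0 // ltW.
  rewrite mulrC ler_pM2l // ler_pdivrMr; last by rewrite ltr0n; lia.
  rewrite natrM mulKf // ler_nat; lia.
have [jl|jl] := leqP (2 * j).+1 (2 * k).
  by rewrite (minn_idPl _) ?H //; lia.
have E : midpoint R (2 * k) j = pi - midpoint R (2 * k) (2 * k - j.+1).
  apply/eqP; rewrite eq_sym subr_eq /midpoint -mulrDl -natrD.
  have -> : ((2 * j).+1 + (2 * (2 * k - j.+1)).+1 = 2 * (2 * k))%N by lia.
  by rewrite mulrC divfK // pnatr_eq0; lia.
rewrite (minn_idPr _); last by lia.
rewrite E sinB sinpi cospi mul0r sub0r mulN1r opprK H //; lia.
Qed.

(** The bounds 1 and 2 / (k s sin th) of the square combine to a multiple of 1
    / (4 + s i), where i is the number of steps from the nearer end of [0, pi];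
    the sum over both ends is symmetric under j |-> 2 k - 1 - j. *)
Lemma legendre_parallel_midpoint k t j : (j < 2 * k)%N -> -1 <= t <= 1 ->
  (P k).[t ^+ 2 + (1 - t ^+ 2) * cos (midpoint R (2 * k) j)] ^+ 2 <=
  8 * (4 + sin_of t * j%:R)^-1 + 8 * (4 + sin_of t * (2 * k - j.+1)%:R)^-1.
Proof.
move=> jk t1; set s := sin_of t.
have s0 : 0 <= s by exact: sqrtr_ge0.
set y := t ^+ 2 + _; set p := (P k).[y].
pose i := minn j (2 * k - j.+1).
have k0 : (0 < k)%N by lia.
have kR : 0 < k%:R :> R by rewrite ltr0n.
have p1 : p ^+ 2 <= 1.
  by rewrite -[p ^+ 2]real_normK ?num_real // expr_le1 // legendre_parallel_le1.
have pS : s * i%:R * p ^+ 2 <= 4.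
  have sn := sin_midpoint_ge jk.
  have sn0 : 0 <= sin (midpoint R (2 * k) j).
    by apply: le_trans sn; rewrite divr_ge0.
  have H1 := legendre_bernstein k0 (parallel_bounds (midpoint R (2 * k) j) t1).
  have H2 := parallel_sqrt_le t1 sn0.
  have H3 : s * (i%:R / (2 * k)%:R) * p ^+ 2 <= 2 / k%:R.
    apply: le_trans H1; rewrite ler_wpM2r ?sqr_ge0 //.
    by apply: le_trans H2; rewrite ler_wpM2l.
  have -> : s * i%:R * p ^+ 2 = s * (i%:R / (2 * k)%:R) * p ^+ 2 * (2 * k)%:R.
    by rewrite natrM; field; rewrite gt_eqF.
  have -> : 4 = 2 / k%:R * (2 * k)%:R :> R.
    by rewrite natrM; field; rewrite gt_eqF.
  by rewrite ler_wpM2r.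
have q0 n : 0 < 4 + s * n%:R by rewrite ltr_wpDr // mulr_ge0.
have : p ^+ 2 <= 8 * (4 + s * i%:R)^-1.
  rewrite ler_pdivlMr // mulrDr; move: pS p1.
  by rewrite [p ^+ 2 * (s * _)]mulrC; lra.
have v0 n : 0 <= 8 * (4 + s * n%:R)^-1 by rewrite mulr_ge0 // invr_ge0 ltW.
move/le_trans; apply; rewrite /i.
by case: leqP => _; rewrite ?lerDl ?lerDr.
Qed.

(** The main estimate. By [discrete_parseval] and [legendre_addition] the
    left-hand side is s times the mean of P_k(t^2 + (1 - t^2) cos th)^2 over
    the sampled angles th, which [legendre_parallel_midpoint] bounds by a
    harmonic sum. *)
Lemma zonal_sqr_sum_le k t : (0 < k)%N -> -1 <= t <= 1 ->
  sin_of t * zonal_sqr_sum k t <=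
  8 / k%:R * (sin_of t / 4 + ln (1 + sin_of t * k%:R / 2)).
Proof.
move=> k0 t1; set s := sin_of t; have s0 : 0 <= s by exact: sqrtr_ge0.
have kR : 0 < k%:R :> R by rewrite ltr0n.
have k2 : 0 < (2 * k)%:R :> R by rewrite ltr0n; lia.
have := @discrete_parseval R (zonal_coef k ^~ t) k (2 * k).
rewrite -/(zonal_sqr_sum k t) => /(_ _)/esym H.
have -> : s * zonal_sqr_sum k t =
    s * ((2 * k)%:R * zonal_sqr_sum k t) / (2 * k)%:R.
  by rewrite mulrCA [RHS]mulrAC divff ?mul1r ?gt_eqF.
rewrite H; last by lia.
rewrite ler_pdivrMr //.
have -> : 8 / k%:R * (s / 4 + ln (1 + s * k%:R / 2)) * (2 * k)%:R =
   16 * (s / 4 + ln (1 + s * (2 * k)%:R / 4)).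
  have -> : s * (2 * k)%:R / 4 = s * k%:R / 2 by rewrite natrM; field.
  by rewrite natrM; field; rewrite gt_eqF.
have S : \sum_(j < 2 * k)
    cosine_sum (zonal_coef k ^~ t) k (midpoint R (2 * k) j) ^+ 2 <=
   16 * \sum_(j < 2 * k) (4 + s * j%:R)^-1.
  apply: (@le_trans _ _ (\sum_(j < 2 * k)
     (8 * (4 + s * j%:R)^-1 + 8 * (4 + s * (2 * k - j.+1)%:R)^-1))).
    apply: ler_sum => j _; rewrite legendre_addition //.
    exact: legendre_parallel_midpoint.
  rewrite big_split /= [X in _ + X](reindex_inj rev_ord_inj) /=.
  rewrite [X in _ + X](eq_bigr (fun j : 'I_(2 * k) => 8 * (4 + s * j%:R)^-1)).
    by rewrite -!mulr_sumr; lra.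
  move=> j _; have -> // : (2 * k - (2 * k - j.+1).+1 = j)%N.
  by have := ltn_ord j; lia.
apply: le_trans (ler_wpM2l s0 S) _.
have -> (x : R) : s * (16 * x) = 16 * (s * x) by ring.
by rewrite ler_pM2l // harmonic_sum_le.
Qed.

End zonal_l2.

(** * Integration over the sphere *)

Section sphere_integral.
Variable R : realType.
Local Open Scope ereal_scope.

Local Notation mu := (@lebesgue_measure R).
Local Notation D := (@coord_domain R).
Local Notation psi := (@spherical_coord R).
Local Notation nu := (@sphere_area R).
Import HBNNSimple.

Let mD : measurable D. Proof. exact: measurable_coord_domain. Qed.

Let mpsi : measurable_fun setT psi.
Proof. exact: measurable_spherical_coord. Qed.

Let msin : measurable_fun setT (fun p : R * R => (sin p.1)%:E).
Proof.
apply/measurable_EFinP; apply: measurableT_comp (measurable_fst).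
by apply: continuous_measurable_fun; exact: continuous_sin.
Qed.

Let density_ge0 p : D p -> 0 <= (sin p.1)%:E.
Proof. by move=> pD; rewrite lee_fin sin_coord_domain_ge0. Qed.

(** For indicators this is the definition of the area; it extends to simple
    functions by linearity and to the limit by monotone convergence. *)
Lemma ge0_integral_sphere_area (f : R * R * R -> \bar R) :
  measurable_fun setT f -> (forall x, 0 <= f x) ->
  \int[nu]_x f x = \int[mu \x mu]_(p in D) (f (psi p) * (sin p.1)%:E).
Proof.
move=> mf f0.
pose h := nnsfun_approx measurableT mf.
have hf x : EFin \o h ^~ x @ \oo --> f x.
  exact: cvg_nnsfun_approx.
have -> : \int[nu]_x f x = limn (fun n => \int[nu]_x (h n x)%:E).
  rewrite -monotone_convergence //.
  - by apply: eq_integral => x _; apply/esym/cvg_lim => //; exact: hf.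
  - by move=> n; exact/measurable_EFinP/measurable_funP.
  - by move=> n x _; rewrite lee_fin.
  - by move=> x _ a b ab; rewrite lee_fin; exact/lefP/nd_nnsfun_approx.
have mhp n : measurable_fun D (fun p => (h n (psi p))%:E).
  apply: measurable_funTS; apply/measurable_EFinP.
  exact: measurableT_comp (measurable_funP (h n)) mpsi.
have mDsin : measurable_fun D (fun p : R * R => (sin p.1)%:E).
  exact: measurable_funTS.
have -> : \int[mu \x mu]_(p in D) (f (psi p) * (sin p.1)%:E) =
   limn (fun n => \int[mu \x mu]_(p in D) ((h n (psi p))%:E * (sin p.1)%:E)).
  rewrite -monotone_convergence //.
  - apply: eq_integral => p _; apply/esym/cvg_lim => //.
    by apply: cvgeZr => //; exact: hf.
  - by move=> n; apply: emeasurable_funM; [exact: mhp|exact: mDsin].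
  - by move=> n p Dp; rewrite mule_ge0 ?lee_fin // -lee_fin; exact: density_ge0.
  - move=> p Dp a b ab; rewrite lee_wpmul2r ?density_ge0 // lee_fin.
    exact/lefP/nd_nnsfun_approx.
congr (limn _); apply/funext => n.
transitivity (\int[nu]_x (\sum_(y \in range (h n))
    (y * \1_(h n @^-1` [set y]) x)%:E)).
  by apply: eq_integral => x _; rewrite fimfunE -fsumEFin.
rewrite ge0_integral_fsum //; last 2 first.
- by move=> r; apply/measurable_EFinP; exact: measurable_funM.
- by move=> r x _; exact: nnfun_muleindic_ge0.
transitivity (\int[mu \x mu]_(p in D) (\sum_(y \in range (h n))
    (y * \1_(h n @^-1` [set y]) (psi p))%:E * (sin p.1)%:E)); last first.
  apply: eq_integral => p _.
  rewrite -ge0_mule_fsuml => [|y]; last exact: nnfun_muleindic_ge0.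
  by rewrite fsumEFin // -(fimfunE _ (psi p)).
have mI r : measurable_fun setT (fun p => \1_(h n @^-1` [set r]) (psi p) : R).
  have mI1 : measurable_fun setT (\1_(h n @^-1` [set r]) : R * R * R -> R).
    exact: measurable_indic.
  exact: measurableT_comp mI1 mpsi.
have mi r : measurable_fun D (fun p => (r * \1_(h n @^-1` [set r]) (psi p))%:E).
  apply: measurable_funTS; apply/measurable_EFinP.
  exact: measurable_funM (mI r).
rewrite ge0_integral_fsum //; last 2 first.
- by move=> r; apply: emeasurable_funM; [exact: mi|exact: mDsin].
- by move=> r p Dp; rewrite mule_ge0 ?density_ge0 // nnfun_muleindic_ge0.
apply: eq_fsbigr => r rh.
rewrite integralZl_indic_nnsfun //.
under [RHS]eq_integral do rewrite EFinM -muleA.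
rewrite ge0_integralZl //.
- congr (_ * _); rewrite integral_indic // setIT.
  rewrite -[LHS]/(sphere_area (h n @^-1` [set r])) /sphere_area.
  rewrite integral_mkcondr.
  apply: eq_integral => p _.
  by rewrite epatch_indic muleC.
- apply: emeasurable_funM mDsin; apply: measurable_funTS.
  by apply/measurable_EFinP; exact: mI.
- by move=> p Dp; rewrite mule_ge0 ?density_ge0 // lee_fin indicE ler0n.
- by move: rh; rewrite inE => -[x _ <-]; rewrite lee_fin.
Qed.

Lemma measurable_sphere2 : measurable (@sphere2 R).
Proof.
have m1 : measurable_fun setT (fun x : R * R * R => x.1.1).
  exact: measurableT_comp measurable_fst measurable_fst.
have m2 : measurable_fun setT (fun x : R * R * R => x.1.2).
  exact: measurableT_comp measurable_snd measurable_fst.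
have m3 : measurable_fun setT (fun x : R * R * R => x.2).
  exact: measurable_snd.
pose F (x : R * R * R) : R := (x.1.1 ^+ 2 + x.1.2 ^+ 2 + x.2 ^+ 2)%R.
have mF : measurable_fun setT F.
  by apply: measurable_funD; [apply: measurable_funD|]; exact: measurable_funX.
rewrite (_ : @sphere2 R = setT `&` F @^-1` [set 1%R]); last by rewrite setTI.
exact: mF.
Qed.

Lemma integral_coord_domain (G : R -> R) : measurable_fun setT G ->
  {in `[0%R, pi], forall x, (0 <= G x)%R} ->
  \int[mu \x mu]_(p in D) (G p.1)%:E =
  (2 * pi)%:E * \int[mu]_(x in `[0%R, pi]) (G x)%:E.
Proof.
move=> mG G0.
rewrite integral_mkcond.
rewrite fubini_tonelli1; last 2 first.
- apply/(measurable_restrictT _ mD); apply: measurable_funTS.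
  by apply/measurable_EFinP; exact: measurableT_comp mG measurable_fst.
- move=> p; apply: erestrict_ge0 => {}p [/= p1 _]; rewrite lee_fin; exact: G0.
have mG1 : measurable_fun `[0%R, pi] (fun x => (G x)%:E).
  by apply: measurable_funTS; exact/measurable_EFinP.
rewrite -ge0_integralZl //; last by rewrite lee_fin mulr_ge0 // pi_ge0.
rewrite [RHS]integral_mkcond; apply: eq_integral => x _.
rewrite /fubini_F patchE.
have [xpi|xpi] := ifPn.
  transitivity (\int[mu]_(y in `[0%R, (2 * pi)%R]) (cst (G x)%:E y)).
    rewrite [RHS]integral_mkcond; apply: eq_integral => y _.
    rewrite !patchE; case: ifPn => [|/negP yn]; rewrite ?inE.
      by move=> [/= _ y2]; rewrite ifT // inE.
    rewrite ifN //; apply/negP; rewrite inE => y2; apply: yn.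
    by rewrite inE; split => //=; rewrite inE in xpi.
  rewrite integral_cst //= lebesgue_measure_itv /= lte_fin.
  by rewrite mulr_gt0 ?pi_gt0 // -EFinD subr0 muleC.
rewrite integral0_eq // => y _; rewrite patchE ifN //.
by apply/negP; rewrite inE => -[/= x1 _]; move/negP: xpi; apply; rewrite inE.
Qed.

Lemma integral_sphere_height (g : R -> R) : measurable_fun setT g ->
  {in `[(-1)%R, 1%R], forall t, (0 <= g t)%R} ->
  \int[nu]_(x in @sphere2 R) (g x.2)%:E =
  (2 * pi)%:E * \int[mu]_(x in `[0%R, pi]) (g (cos x) * sin x)%:E.
Proof.
move=> mg g0.
have mcos : measurable_fun setT (@cos R).
  by apply: continuous_measurable_fun; exact: continuous_cos.
have msin1 : measurable_fun setT (@sin R).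
  by apply: continuous_measurable_fun; exact: continuous_sin.
have gc x : (0 <= g (cos x))%R.
  by apply: g0; rewrite in_itv /= cos_geN1 cos_le1.
rewrite -integral_coord_domain; last 2 first.
- by apply: measurable_funM => //; exact: measurableT_comp mg mcos.
- by move=> x; rewrite in_itv /= => xpi; rewrite mulr_ge0 // sin_ge0_pi.
rewrite integral_mkcond ge0_integral_sphere_area.
- apply: eq_integral => p _; rewrite patchE ifT ?EFinM //.
  by rewrite inE; exact: spherical_coordP.
- apply/(measurable_restrictT _ measurable_sphere2); apply: measurable_funTS.
  by apply/measurable_EFinP; exact: measurableT_comp mg measurable_snd.
- move=> x; apply: erestrict_ge0 => {}x; rewrite /sphere2 /= => xS.
  rewrite lee_fin g0 // in_itv /=.
  have := sqr_ge0 x.1.1; have := sqr_ge0 x.1.2; nra.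
Qed.

Lemma integral_sphere_poly (p : {poly R}) :
  {in `[(-1)%R, 1%R], forall t, (0 <= p.[t])%R} ->
  \int[nu]_(x in @sphere2 R) (p.[x.2])%:E = (2 * pi * interval_integral p)%:E.
Proof.
move=> p0.
rewrite (integral_sphere_height (g := horner p)) //; last first.
  by apply: continuous_measurable_fun; exact: continuous_horner.
rewrite [RHS]EFinM; congr (_ * _).
pose F (x : R) : R := (- (prim p).[cos x])%R.
have dF (x : R) : is_derive x (1 : R)%R F (p.[cos x] * sin x)%R.
  have H := is_derive1_comp (is_derive_poly (prim p) (cos x)) (is_derive_cos x).
  apply: is_derive_eq (is_deriveN H) _.
  by rewrite deriv_prim mulrN opprK.
rewrite (@continuous_FTC2 R (fun x => (p.[cos x] * sin x)%R) F).
- rewrite /F cos0 cospi /interval_integral -EFinB opprK addrC //.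
- exact: pi_gt0.
- apply: continuous_subspaceT => x; apply: cvgM; last exact: continuous_sin.
  by apply: continuous_comp; [exact: continuous_cos|exact: continuous_horner].
- have cF : continuous F.
    move=> x; apply/differentiable_continuous/derivable1_diffP.
    by have [] := dF x.
  split => [x _||].
  + by have [] := dF x.
  + exact/cvg_at_right_filter/cF.
  + exact/cvg_at_left_filter/cF.
- by move=> x _; have H := dF x; rewrite derive1E derive_val.
Qed.

Lemma integral_sphere_height_le (g : R -> R) (B : R) : measurable_fun setT g ->
  {in `[(-1)%R, 1%R], forall t, (0 <= g t)%R} ->
  {in `[0%R, pi], forall x, (g (cos x) * sin x <= B)%R} ->
  \int[nu]_(x in @sphere2 R) (g x.2)%:E <= (2 * pi * (B * pi))%:E.
Proof.
move=> mg g0 gB; rewrite integral_sphere_height // [leRHS]EFinM.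
rewrite lee_pmul2l //; last by rewrite lte_fin mulr_gt0 // pi_gt0.
have gc x : (0 <= g (cos x))%R.
  by apply: g0; rewrite in_itv /= cos_geN1 cos_le1.
have -> : (B * pi)%:E = \int[mu]_(x in `[0%R, pi]) (cst B%:E x).
  rewrite integral_cst //= lebesgue_measure_itv /= lte_fin pi_gt0.
  by rewrite -EFinD subr0.
apply: ge0_le_integral => //.
- move=> x; rewrite /= in_itv /= => xpi.
  by rewrite lee_fin mulr_ge0 // sin_ge0_pi.
- apply/measurable_EFinP; apply: measurable_funTS; apply: measurable_funM.
    apply: measurableT_comp mg _.
    by apply: continuous_measurable_fun; exact: continuous_cos.
  by apply: continuous_measurable_fun; exact: continuous_sin.
Qed.

End sphere_integral.

(** * Spherical harmonics *)

Section harmonics.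
Variable R : realType.
Implicit Types (k : nat) (m : int) (t : R) (x : R * R * R).

Lemma sin_le_id (y : R) : 0 <= y -> sin y <= y.
Proof.
move=> y0; pose f : R -> R := id - sin.
have df (z : R) : is_derive z (1 : R) f (1 - cos z).
  exact: is_deriveB.
have H : f 0 <= f y.
  apply: (@ger0_derive1_ndecr _ f 0 y _ _ _ 0 y (lexx 0) y0 (lexx y))
    => [z _|z _|].
  - by case: (df z).
  - by have H := df z; rewrite derive1E derive_val subr_ge0 cos_le1.
  - by apply: derivable_within_continuous => z _; case: (df z).
by move: H; rewrite /f !fctE /= sin0 subrr subr_ge0.
Qed.

Lemma sphere2_height x : sphere2 x -> -1 <= x.2 <= 1.
Proof.
move=> xS; have := sqr_ge0 x.1.1; have := sqr_ge0 x.1.2; move: xS.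
rewrite /sphere2 /=; nra.
Qed.

Lemma sphere2_polar x : sphere2 x -> exists phi th : R,
  [/\ 0 <= phi <= pi, 0 <= th <= 2 * pi & x = spherical_coord (phi, th)].
Proof.
move=> xS; have t1 := sphere2_height xS.
have pi0 := pi_gt0 R.
case: x xS t1 => [[a b] t] xS t1; rewrite /sphere2 /= in xS t1.
pose s := Num.sqrt (1 - t ^+ 2).
have s0 : 0 <= s by exact: sqrtr_ge0.
have ss : s ^+ 2 = a ^+ 2 + b ^+ 2.
  by rewrite sqr_sqrtr; [rewrite -xS addrK|nra].
have sab : `|a| <= s.
  by rewrite -sqrtr_sqr ler_wsqrtr // -xS addrK lerDl sqr_ge0.
exists (acos t).
have phi1 : 0 <= acos t <= pi by rewrite acos_ge0 ?acos_lepi.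
have ct : cos (acos t) = t by rewrite acosK // in_itv.
have st : sin (acos t) = s by rewrite sin_acos.
have [s00|sn0] := eqVneq s 0.
  exists 0; split => //; first by rewrite lexx mulr_ge0 // ltW.
  have a0 : a = 0 by apply/normr0_eq0/eqP; rewrite eq_le normr_ge0 andbT -s00.
  have b0 : b = 0.
    by apply/eqP; rewrite -sqrf_eq0; apply/eqP; move: ss; rewrite s00 a0; lra.
  by rewrite /spherical_coord /= ct st s00 a0 b0 !mul0r.
have sp : 0 < s by rewrite lt_def sn0.
have as1 : -1 <= a / s <= 1.
  by rewrite -ler_norml normrM normfV (ger0_norm s0) ler_pdivrMr // mul1r.
have ca : cos (acos (a / s)) = a / s by rewrite acosK // in_itv.
have a1 : 0 <= acos (a / s) <= pi by rewrite acos_ge0 ?acos_lepi.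
have sa : sin (acos (a / s)) = `|b| / s.
  rewrite sin_acos // -[`|b|]sqrtr_sqr -{2}(ger0_norm s0) -(sqrtr_sqr s).
  rewrite -sqrtrV ?sqr_ge0 // -sqrtrM ?sqr_ge0 //; congr Num.sqrt.
  have -> : b ^+ 2 = s ^+ 2 - a ^+ 2 by rewrite ss; ring.
  by field.
have [b0|b0] := leP 0 b.
  exists (acos (a / s)); split => //; first by lra.
  rewrite /spherical_coord /= ct st ca sa ger0_norm //.
  by congr (_, _, _); field.
(* On the other half of the parallel the longitude is reflected. *)
exists (pi *+ 2 - acos (a / s)); split => //; first by lra.
rewrite /spherical_coord /= ct st cosB sinB cos2pi sin2pi ca sa ltr0_norm //.
by congr (_, _, _); field.
Qed.

Lemma cmodM (z1 z2 : R[i]) : cmod (z1 * z2) = cmod z1 * cmod z2.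
Proof. exact: ComplexField.Normc.normcM. Qed.

Lemma cmod_real (a : R) : cmod (a%:C)%C ^+ 2 = a ^+ 2.
Proof. by rewrite /cmod /= expr0n addr0 sqr_sqrtr ?sqr_ge0. Qed.

Lemma cmod_expi (a : R) : cmod (expi a) ^+ 2 = 1.
Proof. by rewrite /cmod /expi /= cos2Dsin2 sqrtr1 expr1n. Qed.

Lemma assoc_legendre_sqr k m : (`|m| <= k)%N -> exists2 g : R, 0 <= g &
  forall t, -1 <= t <= 1 -> assoc_legendre k m t ^+ 2 = g * zonal_coef k `|m| t.
Proof.
have nat_sqr n t : -1 <= t <= 1 -> assoc_legendre_nat k n t ^+ 2 =
    (k + n)`!%:R / (k - n)`!%:R * zonal_coef k n t.
  move=> t1; rewrite /assoc_legendre_nat /zonal_coef !exprMn.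
  rewrite exprAC sqrrN !expr1n mul1r -exprM mulnC exprM sqr_sqrtr; last by nra.
  by field; rewrite !pnatr_eq0 -!lt0n !fact_gt0.
case: m => [n|n] /= nk.
  by exists ((k + n)`!%:R / (k - n)`!%:R) => //; exact: nat_sqr.
set c := (-1) ^+ n.+1 * ((k - n.+1)%N`!%:R / (k + n.+1)%N`!%:R) : R.
exists (c ^+ 2 * ((k + n.+1)`!%:R / (k - n.+1)`!%:R)).
  by rewrite mulr_ge0 ?sqr_ge0 // divr_ge0.
by move=> t t1; rewrite exprMn nat_sqr // mulrA.
Qed.

(** The value at coinciding points of the reproducing kernel of the spherical
    harmonics of degree k. *)
Definition zonal_mass k : R := (2 * k).+1%:R / (4 * pi).

(** By its explicit form |Y m|^2 is a constant times [zonal_coef]; the constant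
    is found by integrating over the sphere with [interval_integral_zonal]. *)
Lemma harmonic_sqr k (Y : int -> R * R * R -> R[i]) m x :
  standard_spherical_harmonics k Y -> - k%:Z <= m <= k%:Z -> sphere2 x ->
  cmod (Y m x) ^+ 2 = zonal_mass k * zonal_coef k `|m| x.2.
Proof.
move=> [c /(_ m) +] mk xS => /(_ mk)[YE Y1].
have pi0 := pi_gt0 R.
have mk' : (`|m| <= k)%N by lia.
have [g g0 gE] := assoc_legendre_sqr mk'.
pose h := cmod (c m) ^+ 2 * g.
have sqrE z : sphere2 z -> cmod (Y m z) ^+ 2 = h * zonal_coef k `|m| z.2.
  move=> zS; have z1 := sphere2_height zS.
  have [phi [th [phi1 th1 zE]]] := sphere2_polar zS.
  rewrite zE YE // !cmodM !exprMn cmod_real cmod_expi mulr1 gE ?mulrA //.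
  by rewrite cos_geN1 cos_le1.
have h0 : 0 <= h by rewrite mulr_ge0 ?sqr_ge0.
have : (\int[@sphere_area R]_(z in @sphere2 R)
    ((h *: zonal_poly R k `|m|%N).[z.2])%:E = 1)%E.
  rewrite -Y1; apply: eq_integral => z; rewrite inE => zS.
  by rewrite sqrE // hornerZ zonal_polyE.
rewrite integral_sphere_poly; last first.
  move=> t; rewrite in_itv /= => t1; rewrite hornerZ zonal_polyE.
  by rewrite mulr_ge0 // zonal_coef_ge0.
rewrite (interval_integralZ h) interval_integral_zonal // => -[E].
rewrite sqrE //; congr (_ * _).
have k1 : (2 * k).+1%:R != 0 :> R by rewrite pnatr_eq0.
have -> : h = 2 * pi * (h * (2 / (2 * k).+1%:R)) * ((2 * k).+1%:R / (4 * pi)).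
  move: ((2 * k).+1%:R : R) k1 (pi : R) pi0 => K K0 p p0.
  by field; rewrite K0 gt_eqF.
by rewrite E mul1r.
Qed.

Lemma sum_orders_abs (V : nmodType) k (f : nat -> V) :
  sum_orders k (fun m => f `|m|%N) = f 0%N + (\sum_(m < k) f m.+1) *+ 2.
Proof.
rewrite /sum_orders.
rewrite -(big_mkord xpredT (fun i => f `|(i%:Z - k%:Z)%R|%N)).
rewrite (_ : (2 * k).+1 = k + k.+1)%N; last by lia.
rewrite (@big_cat_nat _ _ _ k) //=; last by lia.
have -> : \sum_(0 <= i < k) f `|(i%:Z - k%:Z)%R|%N = \sum_(m < k) f m.+1.
  rewrite big_mkord (reindex_inj rev_ord_inj) /=; apply: eq_bigr => i _.
  by congr f; have := ltn_ord i; lia.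
have -> : \sum_(k <= i < k + k.+1) f `|(i%:Z - k%:Z)%R|%N =
    f 0%N + \sum_(m < k) f m.+1.
  have := big_addn 0 (k + k.+1) k xpredT (fun i => f `|(i%:Z - k%:Z)%R|%N).
  rewrite add0n addKn => ->; rewrite big_mkord big_ord_recl /=.
  congr (_ + _); first by congr f; lia.
  by apply: eq_bigr => i _; congr f; rewrite /bump /=; lia.
by rewrite addrCA mulr2n.
Qed.

Lemma order_range k (i : 'I_(2 * k).+1) : - k%:Z <= i%:Z - k%:Z <= k%:Z.
Proof. by have := ltn_ord i; lia. Qed.

Lemma sum_harmonic4 k (Y : int -> R * R * R -> R[i]) x :
  standard_spherical_harmonics k Y -> sphere2 x ->
  sum_orders k (fun m => cmod (Y m x) ^+ 4) =
  zonal_mass k ^+ 2 * zonal_sqr_sum k x.2.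
Proof.
move=> hY xS.
transitivity (sum_orders k
    (fun m : int => (zonal_mass k * zonal_coef k `|m| x.2) ^+ 2)).
  apply: eq_bigr => i _; rewrite -(harmonic_sqr hY (order_range i) xS).
  by rewrite -exprM.
rewrite (sum_orders_abs _ (fun n => (zonal_mass k * zonal_coef k n x.2) ^+ 2)).
rewrite /zonal_sqr_sum mulrDr -exprMn; congr (_ + _).
rewrite -[LHS]mulr_natl [RHS]mulrCA; congr (_ * _).
by rewrite mulr_sumr; apply: eq_bigr => i _; rewrite exprMn.
Qed.

Lemma zonal_mass_bounds k : (0 < k)%N -> 0 <= zonal_mass k <= k%:R.
Proof.
move=> k0; have pi2 := pi_ge2 R; have pi0 := pi_gt0 R.
have k1 : 1 <= k%:R :> R by rewrite ler1n.
rewrite /zonal_mass divr_ge0 ?mulr_ge0 ?pi_ge0 //=.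
rewrite ler_pdivrMr ?mulr_gt0 //.
have -> : (2 * k).+1%:R = 2 * k%:R + 1 :> R by ring.
nra.
Qed.

(** ln 2 >= 1/2, from ln (1 - 1/2) <= - 1/2. *)
Lemma ln_ge_half (y : R) : 2 <= y -> 2^-1 <= ln y.
Proof.
move=> y2; have H : ln (1 + - 2^-1) <= - 2^-1 :> R by apply: le_ln1Dx; lra.
apply: le_trans (_ : ln 2 <= _); last by rewrite ler_ln ?posrE //; lra.
move: H; have -> : 1 + - 2^-1 = 2^-1 :> R by field.
by rewrite lnV ?posrE // lerN2.
Qed.

End harmonics.

(** * The two estimates *)

Section estimates.
Variable R : realType.
Implicit Types (k : nat) (m : int) (t : R) (x : R * R * R).

(** Both angles to the poles have the same sine, which is the radius of the
    parallel through x. *)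
Lemma pole_dist_spec x : sphere2 x ->
  0 <= pole_dist x <= pi / 2 /\ sin (pole_dist x) = Num.sqrt (1 - x.2 ^+ 2).
Proof.
move=> xS; have t1 := sphere2_height xS; have pi0 := pi_gt0 R.
rewrite /pole_dist /geodesic_dist.
have -> : dot3 x (north_pole R) = x.2 by rewrite /dot3 /=; ring.
have -> : dot3 x (opp3 (north_pole R)) = - x.2 by rewrite /dot3 /=; ring.
rewrite acosN // -sin_acos //.
have := acos_ge0 t1; have := acos_lepi t1; move: (acos x.2) => a a1 a0.
rewrite minEle; case: ifPn => [H|]; first by split => //; lra.
rewrite -ltNge => H; split; first by lra.
by rewrite sinB sinpi cospi mul0r sub0r mulN1r opprK.
Qed.

(** The constant: [zonal_sqr_sum_le] reads k s Z <= 2 s + 8 ln (1 + k s / 2).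
    Here r/2 <= s <= r, and k r >= 2 implies 1 + k s / 2 <= k r, so the
    logarithmic term contributes 16. The term 2 s contributes 8 because r <= 2
    <= 4 ln (k r). *)
Lemma zonal_sqr_sum_le_dist k t r : (2 <= k)%N -> -1 <= t <= 1 ->
  2 / k%:R <= r <= pi / 2 -> sin r = Num.sqrt (1 - t ^+ 2) ->
  zonal_sqr_sum k t <= 24 * ln (k%:R * r) / (k%:R * r).
Proof.
move=> k2 t1 /andP[r1 r2] sr.
have k0 : (0 < k)%N by lia.
have kR : 0 < k%:R :> R by rewrite ltr0n.
have r0 : 0 < r by apply: lt_le_trans r1; rewrite divr_gt0.
have pi2 : pi / 2 < 2 :> R by exact: pihalf_lt2.
have s1 : r / 2 <= sin r by apply: half_le_sin; lra.
have s2 : sin r <= r by apply: sin_le_id; lra.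
have kr : 2 <= k%:R * r by move: r1; rewrite ler_pdivrMr // mulrC.
have l2 := ln_ge_half kr.
have H := zonal_sqr_sum_le k0 t1; rewrite -sr in H.
have l1 : ln (1 + sin r * k%:R / 2) <= ln (k%:R * r).
  have : sin r * k%:R <= r * k%:R by rewrite ler_wpM2r.
  have : 0 <= sin r * k%:R by rewrite mulr_ge0 //; lra.
  rewrite [r * _]mulrC => A B; rewrite ler_ln ?posrE; lra.
have {}H : sin r * zonal_sqr_sum k t <=
    8 / k%:R * (sin r / 4 + ln (k%:R * r)).
  by apply: (le_trans H); rewrite ler_wpM2l ?divr_ge0 // lerD2l.
move: (zonal_sqr_sum k t) (ln (k%:R * r)) (sin r) s1 s2 l2 H {sr l1}.
move=> Z L s s1 s2 l2 H.
rewrite ler_pdivlMr ?mulr_gt0 //.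
have sp : 0 < s by lra.
have {}H : k%:R * (s * Z) <= 2 * s + 8 * L.
  have := ler_wpM2l (ltW kR) H.
  have -> // : k%:R * (8 / k%:R * (s / 4 + L)) = 2 * s + 8 * L.
  by field; rewrite gt_eqF.
rewrite -(ler_pM2l sp).
have -> : s * (Z * (k%:R * r)) = (k%:R * (s * Z)) * r by ring.
apply: (le_trans (ler_wpM2r (ltW r0) H)).
nra.
Qed.

Lemma zonal_mass_sqr_le k (Z B : R) : (0 < k)%N -> 0 <= B -> Z <= B ->
  zonal_mass R k ^+ 2 * Z <= k%:R ^+ 2 * B.
Proof.
move=> k0 B0 ZB; have /andP[m0 m1] := zonal_mass_bounds R k0.
apply: (le_trans (ler_wpM2l (sqr_ge0 _) ZB)); rewrite ler_wpM2r //.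
by rewrite ler_pXn2r ?nnegrE.
Qed.

Lemma zonal_sqr_sum_ge0 k t : 0 <= zonal_sqr_sum k t.
Proof.
rewrite addr_ge0 ?sqr_ge0 // mulr_ge0 //; apply: sumr_ge0 => i _.
exact: sqr_ge0.
Qed.

Lemma quartic_root_le (S B : R) : 0 <= S -> S <= B ->
  S `^ 4^-1 <= B `^ 4^-1.
Proof.
move=> S0 SB; apply: ge0_ler_powR => //; rewrite nnegrE //.
exact: le_trans SB.
Qed.

Let root81 : 81 `^ 4^-1 = 3 :> R.
Proof.
have -> : 81 = 3 `^ 4 :> R by rewrite powR_mulrn //; ring.
by rewrite -powRrM divff // powRr1.
Qed.

Lemma harmonics_pointwise k (Y : int -> R * R * R -> R[i]) x :
  (2 <= k)%N -> standard_spherical_harmonics k Y -> sphere2 x ->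
  let r := pole_dist x in
  let N4 := sum_orders k (fun m : int => cmod (Y m x) ^+ 4) `^ 4^-1 in
  (2 / k%:R <= r ->
     N4 <= 3 * k%:R `^ 4^-1 * r `^ (- 4^-1) * ln (k%:R * r) `^ 4^-1) /\
  (r <= 2 / k%:R -> N4 <= 3 * k%:R `^ 2^-1).
Proof.
move=> k2 hY xS; rewrite (sum_harmonic4 hY xS).
have k0 : (0 < k)%N by lia.
have kR : 0 < k%:R :> R by rewrite ltr0n.
have t1 := sphere2_height xS.
have [/andP[r0 r2] sr] := pole_dist_spec xS.
have S0 : 0 <= zonal_mass R k ^+ 2 * zonal_sqr_sum k x.2.
  by rewrite mulr_ge0 ?sqr_ge0 ?zonal_sqr_sum_ge0.
split=> [r1|_].
- set r := pole_dist x in r0 r2 r1 sr *.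
  have rp : 0 < r by apply: lt_le_trans r1; rewrite divr_gt0.
  have kr : 2 <= k%:R * r by move: r1; rewrite ler_pdivrMr // mulrC.
  have l2 := ln_ge_half kr.
  have Z1 : zonal_sqr_sum k x.2 <= 24 * ln (k%:R * r) / (k%:R * r).
    by apply: zonal_sqr_sum_le_dist => //; rewrite r1.
  have B0 : 0 <= 24 * ln (k%:R * r) / (k%:R * r).
    by rewrite divr_ge0 // mulr_ge0 //; lra.
  have E : k%:R ^+ 2 * (24 * ln (k%:R * r) / (k%:R * r)) <=
     81 * k%:R * r^-1 * ln (k%:R * r).
    have -> : k%:R ^+ 2 * (24 * ln (k%:R * r) / (k%:R * r)) =
      24 * (k%:R * r^-1 * ln (k%:R * r)) by field; rewrite !gt_eqF.
    (* 24 is rounded up to 81 = 3^4, whose fourth root is the final constant. *)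
    have -> : 81 * k%:R * r^-1 * ln (k%:R * r) =
      81 * (k%:R * r^-1 * ln (k%:R * r)) by ring.
    rewrite ler_wpM2r ?ler_nat // !mulr_ge0 ?invr_ge0 //; lra.
  have SE := le_trans (zonal_mass_sqr_le k0 B0 Z1) E.
  apply: (le_trans (quartic_root_le S0 SE)).
  have l0 : 0 <= ln (k%:R * r) by lra.
  have ri : 0 <= r^-1 by rewrite invr_ge0.
  rewrite !powRM ?mulr_ge0 // root81.
  by rewrite -(powR_inv1 r0) -powRrM mulN1r.
- have E : k%:R ^+ 2 * 1 <= 81 * k%:R ^+ 2 :> R.
    by rewrite mulr1 ler_peMl ?sqr_ge0 // ler1n.
  have Z1 := zonal_sqr_sum_le1 k t1.
  have SE := le_trans (zonal_mass_sqr_le k0 ler01 Z1) E.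
  apply: (le_trans (quartic_root_le S0 SE)).
  rewrite powRM ?exprn_ge0 // root81 -powR_mulrn // -powRrM.
  by have -> : 2%:R * 4^-1 = 2^-1 :> R by field.
Qed.

Definition zonal_sqr_poly k : {poly R} :=
  zonal_poly R k 0 ^+ 2 + 2%:P * \sum_(m < k) zonal_poly R k m.+1 ^+ 2.

Lemma zonal_sqr_polyE k t : (zonal_sqr_poly k).[t] = zonal_sqr_sum k t.
Proof.
rewrite /zonal_sqr_poly hornerD (hornerM 2%:P) hornerC horner_exp zonal_polyE.
rewrite horner_sum; congr (_ + _ * _); apply: eq_bigr => i _.
by rewrite horner_exp zonal_polyE.
Qed.

(** The weight sin phi of the area cancels the factor 1/s in the estimate of
    [zonal_sqr_sum_le], which makes the bound uniform over the sphere. *)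
Lemma zonal_sqr_sum_sin_le k (phi : R) : (2 <= k)%N -> 0 <= phi <= pi ->
  zonal_mass R k ^+ 2 * zonal_sqr_sum k (cos phi) * sin phi <=
  12 * k%:R * ln k%:R.
Proof.
move=> k2 phi1.
have k0 : (0 < k)%N by lia.
have kR : 2 <= k%:R :> R by rewrite ler_nat.
have c1 : -1 <= cos phi <= 1 by rewrite cos_geN1 cos_le1.
have s0 : 0 <= sin phi by exact: sin_ge0_pi.
have s1 : sin phi <= 1 by exact: sin_le1.
have H := zonal_sqr_sum_le k0 c1.
rewrite -sin2cos2 sqrtr_sqr ger0_norm // in H.
have l2 := ln_ge_half kR.
have l1 : ln (1 + sin phi * k%:R / 2) <= ln k%:R.
  have : sin phi * k%:R <= 1 * k%:R by rewrite ler_wpM2r.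
  have : 0 <= sin phi * k%:R by rewrite mulr_ge0.
  by move=> A B; rewrite ler_ln ?posrE; lra.
have B0 : 0 <= 12 / k%:R * ln k%:R :> R by rewrite mulr_ge0 ?divr_ge0 //; lra.
have {}H : sin phi * zonal_sqr_sum k (cos phi) <= 12 / k%:R * ln k%:R.
  apply: (le_trans H).
  have -> : 12 / k%:R * ln k%:R = 8 / k%:R * (3 / 2 * ln k%:R) :> R.
    by field; rewrite gt_eqF; lra.
  by rewrite ler_wpM2l ?divr_ge0 //; lra.
rewrite -mulrA [X in _ * X]mulrC.
apply: (le_trans (zonal_mass_sqr_le k0 B0 H)).
rewrite le_eqVlt; apply/orP; left; apply/eqP; field; rewrite gt_eqF //; lra.
Qed.

(** The functions |Y m|^4 are polynomials in the height on the sphere, hence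
    measurable, and the sum of their integrals is the integral of the sum. *)
Lemma harmonics_integral k (Y : int -> R * R * R -> R[i]) :
  (2 <= k)%N -> standard_spherical_harmonics k Y ->
  ((((2 * k).+1%:R)^-1)%:E *
     sum_orders k (fun m : int =>
       \int[@sphere_area R]_(x in @sphere2 R) (cmod (Y m x) ^+ 4)%:E)
   <= (12 * pi ^+ 2 * ln k%:R)%:E)%E.
Proof.
move=> k2 hY.
have k0 : (0 < k)%N by lia.
have kR : 0 < k%:R :> R by rewrite ltr0n.
pose f (i : 'I_(2 * k).+1) : R * R * R -> \bar R := fun x =>
  (((zonal_mass R k *: zonal_poly R k `|i%:Z - k%:Z|%N) ^+ 2).[x.2])%:E.
have fE (i : 'I_(2 * k).+1) x : sphere2 x ->
    (cmod (Y (i%:Z - k%:Z) x) ^+ 4)%:E = f i x.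
  move=> xS; rewrite /f horner_exp hornerZ zonal_polyE.
  by rewrite -(harmonic_sqr hY (order_range i) xS) -exprM.
have -> : sum_orders k (fun m : int =>
       (\int[@sphere_area R]_(x in @sphere2 R) (cmod (Y m x) ^+ 4)%:E)%E) =
  (\int[@sphere_area R]_(x in @sphere2 R)
     ((zonal_mass R k ^+ 2 *: zonal_sqr_poly k).[x.2])%:E)%E.
  rewrite /sum_orders.
  under eq_bigr => i _.
    rewrite (eq_integral (f i)); last by move=> x; rewrite inE; exact: fE.
    over.
  rewrite -ge0_integral_sum //.
  - apply: eq_integral => x; rewrite inE => xS.
    rewrite hornerZ zonal_sqr_polyE -(sum_harmonic4 hY xS) /sum_orders -sumEFin.
    by apply: eq_bigr => i _; rewrite fE.
  - exact: measurable_sphere2.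
  - move=> i; rewrite /f; apply/measurable_EFinP; apply: measurable_funTS.
    apply: measurableT_comp measurable_snd.
    by apply: continuous_measurable_fun; exact: continuous_horner.
  - by move=> i x _; rewrite lee_fin horner_exp sqr_ge0.
have B := @integral_sphere_height_le R
  (horner (zonal_mass R k ^+ 2 *: zonal_sqr_poly k)) (12 * k%:R * ln k%:R).
apply: (@le_trans _ _ (((2 * k).+1%:R^-1)%:E *
    (2 * pi * (12 * k%:R * ln k%:R * pi))%:E)%E).
  rewrite lee_wpmul2l ?lee_fin ?invr_ge0 //; apply: B.
  - by apply: continuous_measurable_fun; exact: continuous_horner.
  - move=> t _; rewrite hornerZ zonal_sqr_polyE.
    by rewrite mulr_ge0 ?sqr_ge0 ?zonal_sqr_sum_ge0.
  - move=> phi; rewrite in_itv /= => phi1; rewrite hornerZ zonal_sqr_polyE.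
    exact: zonal_sqr_sum_sin_le.
rewrite -EFinM lee_fin mulrC ler_pdivrMr ?ltr0n //.
have l0 : 0 <= ln k%:R :> R by apply: ln_ge0; rewrite ler1n.
have -> : 2 * pi * (12 * k%:R * ln k%:R * pi) =
   12 * pi ^+ 2 * ln k%:R * (2 * k%:R) :> R by ring.
apply: ler_wpM2l; last by rewrite -[(2 * k).+1]addn1 natrD natrM lerDl.
exact: mulr_ge0 (mulr_ge0 _ (sqr_ge0 _)) l0.
Qed.

End estimates.

Theorem theorem1 (R : realType) :
  (exists C : R, forall (k : nat) (Y : int -> R * R * R -> R[i]),
     (2 <= k)%N -> standard_spherical_harmonics k Y ->
     ((((2 * k).+1%:R)^-1)%:E *
        sum_orders k (fun m : int =>
          \int[@sphere_area R]_(x in @sphere2 R) (cmod (Y m x) ^+ 4)%:E)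
      <= (C * ln k%:R)%:E)%E) /\
  (exists C : R, forall (k : nat) (Y : int -> R * R * R -> R[i]),
     (2 <= k)%N -> standard_spherical_harmonics k Y ->
     forall x : R * R * R, sphere2 x ->
       let r := pole_dist x in
       let N4 := sum_orders k (fun m : int => cmod (Y m x) ^+ 4) `^ 4^-1 in
       (2 / k%:R <= r ->
          N4 <= C * k%:R `^ 4^-1 * r `^ (- 4^-1) * ln (k%:R * r) `^ 4^-1) /\
       (r <= 2 / k%:R -> N4 <= C * k%:R `^ 2^-1)).
Proof.
split.
- by exists (12 * pi ^+ 2) => k Y; exact: harmonics_integral.
- by exists 3 => k Y k2 hY x; exact: harmonics_pointwise.
Qed.
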